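(* Suppose $\rho<1$. Then for any $\epsilon>0$ there exists $\bar\beta_\epsilon>0$ such that for all $0<\beta\le\bar\beta_\epsilon$, in the game with payoffs $\mathcal M_i(\cdot;\beta)$: (1) if $\rho\le f(\phi_b)/2$, the pure profile $(f^{-1}(2\rho),f^{-1}(2\rho))$ is an $\epsilon$-Nash equilibrium; and if $f(\phi_b)/2<\rho<1$, the mixed profile $(\sigma^*,\sigma^* )$ is an $\epsilon$-Nash equilibrium; (2) if $f(\phi_b)/2<\rho<1$, the interval $[\phi_L^*,\phi_R^*]$ is an $\epsilon$-equilibrium cycle.
   Context: Fix $\phi_h>0$ and $f:[0,\phi_h]\to\mathbb R$ strictly concave, strictly decreasing and differentiable, with $0<f(\phi)\le 1$ for all $\phi$ and $f(0)=1$. Fix $\Lambda>0$, $e>0$, $\rho:=e/\Lambda$. The extended inverse $f^{-1}:[0,\infty)\to[0,\phi_h]$: $f^{-1}(x)=\phi_h$ for $0\le x<f(\phi_h)$; the unique $\phi$ with $f(\phi)=x$ for $f(\phi_h)\le x\le1$; $0$ for $x>1$. Game for $\beta>0$: two platforms choose prices $\phi_i\in[0,\phi_h]$. For $\phi\in[0,\phi_h]$, $\lambda\in[0,\Lambda]$, let $$\mathcal U(\phi,\lambda;\beta)=\Big(\sum_{n=0}^\infty\frac{e^n}{\prod_{a=1}^n(\lambda f(\phi)+a\beta)}\Big)^{-1},\qquad \mathcal B(\phi,\lambda;\beta)=1-f(\phi)+f(\phi)\,\mathcal U(\phi,\lambda;\beta)$$ ($e^n$ is the $n$-th power of the parameter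 $e$). For $(\phi_1,\phi_2)$, the Wardrop split is $\lambda_1=$ the (unique) minimizer over $\lambda\in[0,\Lambda]$ of $(\mathcal B(\phi_1,\lambda;\beta)-\mathcal B(\phi_2,\Lambda-\lambda;\beta))^2$ and $\lambda_2=\Lambda-\lambda_1$. Payoffs: $\mathcal M_i(\phi_1,\phi_2;\beta)=\lambda_i f(\phi_i)\phi_i(1-\mathcal U(\phi_i,\lambda_i;\beta))$. Mixed strategies are Borel probability measures on $[0,\phi_h]$, with payoffs extended by expectation under independent play. Let $\phi_b:=\max\{\phi\in[0,\phi_h]: f(\phi)+2\phi f'(\phi)\ge0\}$. Let $\phi_L^*$ and $\phi_R^*$ be respectively the maximum value and the maximizer over $[0,\phi_h]$ of $\phi\mapsto(f(\phi)-\rho)\phi/\rho$. When $f(\phi_b)/2<\rho<1$, $\sigma^*$ is the probability measure supported on $[\phi_L^*,\phi_R^*]$ with $$\sigma^*([\phi_L^*,\phi])=\frac{e(\phi+\phi_R^* )-\Lambda f(\phi_R^* )\phi_R^*}{2e\phi-\Lambda f(\phi)\phi},\qquad \phi\in[\phi_L^*,\phi_R^*].$$ A (pure or mixed) profile $\sigma$ is an $\epsilon$-Nash equilibrium if $\mathcal M_i(\phi_i,\sigma_{-i})\le\mathcal M_i(\sigma_i,\sigma_{-i})+\epsilon$ for every $i$ and every $\phi_i\in[0,\phi_h]$. A closed interval $[a,b]$ is an $\epsilon$-equilibrium cycle if (i) for any $i\in\{1,2\}$ and $\phi_{-i}\in[a+\epsilon,b-\epsilon]$ there exists $\phi_i\in[a,b]$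 such that $\mathcal M_i(\phi_i,\phi_{-i})>\mathcal M_i(\tilde\phi_i,\phi_{-i})$ for all $\tilde\phi_i\in[0,\phi_h]\setminus[a-\epsilon,b+\epsilon]$; (ii) for any $(\phi_1,\phi_2)\in[a+\epsilon,b-\epsilon]^2$ there exist $i\in\{1,2\}$ and $\phi_i'\in[a,b]$ such that $\mathcal M_i(\phi_i',\phi_{-i})>\mathcal M_i(\phi_i,\phi_{-i})$ and $\mathcal M_i(\phi_i',\phi_{-i})>\mathcal M_i(\tilde\phi_i,\phi_{-i})$ for all $\tilde\phi_i\in[0,\phi_h]\setminus[a-\epsilon,b+\epsilon]$; (iii) there exists no subset $[c,d]$ of $[a+\epsilon,b-\epsilon]$ that satisfies conditions (i)-(ii) (that is, with $[c,d]$ in the place of $[a,b]$). Here $\mathcal M_i=\mathcal M_i(\cdot;\beta)$ and $-i$ is the other player.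
   Formalization: In condition (iii), the subintervals [c,d] are tested against (i)-(ii) with ε replaced by 0; with the same ε, every [c,d] shorter than 2ε satisfies (i)-(ii) vacuously, so claim (2) would fail for all small ε. *)

(* Defs.v *)
From HB Require Import structures.
From mathcomp Require Import all_boot all_order all_algebra.
From mathcomp Require Import all_classical all_reals all_analysis.

Set Implicit Arguments.
Unset Strict Implicit.
Unset Printing Implicit Defensive.

Import Order.TTheory GRing.Theory Num.Theory.
Import numFieldNormedType.Exports.

Local Open Scope classical_set_scope.
Local Open Scope ring_scope.

Section RealFunctions.
Context {R : realType}.
Implicit Types (D S : set R) (f g : R -> R) (x : R).

Definition strictly_concave_on D f : Prop :=
  forall x y t, D x -> D y -> x != y -> 0 < t < 1 ->
    t * f x + (1 - t) * f y < f (t * x + (1 - t) * y).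

Definition strictly_decreasing_on D f : Prop :=
  forall x y, D x -> D y -> x < y -> f y < f x.

(* Differentiability relative to D: only values of f on D are used, so on a
   segment this is the one-sided notion at the two end points. *)
Definition slope f x : R -> R := fun y => (f y - f x) / (y - x).

Definition derivable_within D f x : Prop :=
  cvg (slope f x @ within D (dnbhs x)).

Definition derive_within D f x : R := lim (slope f x @ within D (dnbhs x)).

(* xget picks an element of the given set; its default 0 is only returned
   when that set is empty. *)
Definition max_of S : R := xget 0 [set x | S x /\ ubound S x].

Definition argmax_on D g : R :=
  xget 0 [set x | D x /\ forall y, D y -> g y <= g x].

Definition argmin_on D g : R :=
  xget 0 [set x | D x /\ forall y, D y -> g x <= g y].

End RealFunctions.

Variant player := P1 | P2.

Definition other (i : player) : player := if i is P1 then P2 else P1.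

Definition coord {T : Type} (i : player) (p : T * T) : T :=
  if i is P1 then p.1 else p.2.

(* The profile in which i plays x and the other player plays y. *)
Definition profile {T : Type} (i : player) (x y : T) : T * T :=
  if i is P1 then (x, y) else (y, x).

(* Two-player games with strategy set [0, h]; M i p is the payoff of i at the
   pure profile p = (phi_1, phi_2), only meaningful for p in [0, h]^2. *)
Section Games.
Context {R : realType}.
Variables (h : R) (M : player -> R * R -> R).

Definition pure_eps_nash (eps : R) (p : R * R) : Prop :=
  (forall i, coord i p \in `[0, h]) /\
  forall i x, x \in `[0, h] ->
    M i (profile i x (coord (other i) p)) <= M i p + eps.

Definition mixed_payoff (i : player) (s : probability R R * probability R R) :
    \bar R :=
  (\int[s.1 \x s.2]_(p in `[0%R, h]%classic `*` `[0%R, h]%classic) (M i p)%:E)%E.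

(* Payoff of i when i plays the pure strategy x and the other plays s. *)
Definition deviation_payoff (i : player) (x : R) (s : probability R R) :
    \bar R :=
  (\int[s]_(y in `[0%R, h]%classic) (M i (profile i x y))%:E)%E.

Definition mixed_eps_nash (eps : R) (s : probability R R * probability R R) :
    Prop :=
  (forall i, coord i s `[0, h]%classic = 1%E) /\
  forall i x, x \in `[0, h] ->
    (deviation_payoff i x (coord (other i) s) <= mixed_payoff i s + eps%:E)%E.

Definition cycle_i (eps a b : R) : Prop :=
  forall i y, y \in `[a + eps, b - eps] ->
    exists2 x, x \in `[a, b] &
      forall z, z \in `[0, h] -> z \notin `[a - eps, b + eps] ->
        M i (profile i z y) < M i (profile i x y).

Definition cycle_ii (eps a b : R) : Prop :=
  forall p : R * R, (forall j, coord j p \in `[a + eps, b - eps]) ->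
    exists i x', [/\ x' \in `[a, b],
      M i p < M i (profile i x' (coord (other i) p)) &
      forall z, z \in `[0, h] -> z \notin `[a - eps, b + eps] ->
        M i (profile i z (coord (other i) p)) <
        M i (profile i x' (coord (other i) p))].

(* In the minimality clause the margin eps is spent on passing from [a, b] to
   [a + eps, b - eps]: the intervals [c, d] are tested against the two
   conditions without a further margin. With margin eps the two conditions hold
   vacuously for every [c, d] shorter than 2 eps (cycle_short below), and no
   interval of length at least 2 eps would be a cycle (no_margin_in_minimality). *)
Definition eps_equilibrium_cycle (eps a b : R) : Prop :=
  [/\ [&& 0 <= a, a <= b & b <= h], cycle_i eps a b, cycle_ii eps a b &
    ~ exists c d, [/\ c <= d, {subset `[c, d] <= `[a + eps, b - eps]},
        cycle_i 0 c d & cycle_ii 0 c d]].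

Lemma cycle_short (eps a b : R) : b - a < 2 * eps ->
  cycle_i eps a b /\ cycle_ii eps a b.
Proof.
rewrite mulr_natl mulr2n => hab.
have hF y : y \in `[a + eps, b - eps] -> False.
  rewrite in_itv /= => /andP[h1 h2].
  have := le_trans h1 h2; rewrite lerBrDr -addrA -lerBrDl => h3.
  by move: (lt_le_trans hab h3); rewrite ltxx.
by split=> [i y /hF//|p /(_ P1)/hF].
Qed.

Lemma no_margin_in_minimality (eps a b : R) : 0 < eps -> 2 * eps <= b - a ->
  exists c d, [/\ c <= d, {subset `[c, d] <= `[a + eps, b - eps]},
    cycle_i eps c d & cycle_ii eps c d].
Proof.
move=> e0 hab; exists (a + eps), (a + eps).
have [|Hi Hii] := @cycle_short eps (a + eps) (a + eps).
  by rewrite subrr mulr_gt0.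
split=> // x; rewrite !in_itv /= => /andP[-> /le_trans->//].
by rewrite lerBrDr -addrA -lerBrDl; move: hab; rewrite mulr_natl mulr2n.
Qed.

End Games.

Section Platforms.
Context {R : realType}.
Variables (phih : R) (f : R -> R) (Lam e : R).

Definition rho : R := e / Lam.

(* For f continuous and strictly decreasing on [0, phih] the set in the
   middle case is a singleton. *)
Definition ext_inv (x : R) : R :=
  if x < f phih then phih
  else if x <= 1 then xget 0 [set phi | phi \in `[0, phih] /\ f phi = x]
  else 0.

Definition calU (beta phi lam : R) : R :=
  (limn (series (fun n =>
     e ^+ n / \prod_(1 <= a < n.+1) (lam * f phi + a%:R * beta))))^-1.

Definition calB (beta phi lam : R) : R := 1 - f phi + f phi * calU beta phi lam.

Definition wardrop (beta : R) (p : R * R) : R :=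
  argmin_on `[0, Lam]%classic
    (fun lam => (calB beta p.1 lam - calB beta p.2 (Lam - lam)) ^+ 2).

Definition load (beta : R) (i : player) (p : R * R) : R :=
  if i is P1 then wardrop beta p else Lam - wardrop beta p.

Definition payoff (beta : R) (i : player) (p : R * R) : R :=
  load beta i p * f (coord i p) * coord i p *
  (1 - calU beta (coord i p) (load beta i p)).

Definition phi_b : R :=
  max_of [set phi | phi \in `[0, phih] /\
    0 <= f phi + 2 * phi * derive_within `[0, phih]%classic f phi].

Definition high_price_gain (phi : R) : R := (f phi - rho) * phi / rho.

Definition phi_L : R := max_of (high_price_gain @` `[0, phih]%classic).

Definition phi_R : R := argmax_on `[0, phih]%classic high_price_gain.

Definition is_sigma_star (s : probability R R) : Prop :=
  s `[phi_L, phi_R]%classic = 1%E /\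
  forall phi, phi \in `[phi_L, phi_R] ->
    s `[phi_L, phi]%classic =
      ((e * (phi + phi_R) - Lam * f phi_R * phi_R) /
       (2 * e * phi - Lam * f phi * phi))%:E.

End Platforms.

(* Main.v *)
(* Write S(mu) for the series with mu = lambda f(phi), so that U = 1/S. The
   recursion S(mu) = 1 + e/(mu + beta) S(mu + beta) shows that the throughput
   v = mu (1 - U) is nondecreasing in mu, and that (mu - v)(e - v) <= beta e;
   hence v = min(mu, e) up to a relative error theta = sqrt(beta/e), uniformly
   in mu. At the Wardrop split the acceptance probabilities P = v/lambda of the
   platforms in use agree, so the payoff at price x against y is, up to
   O(theta): e x if x undercuts y; e G(x) if x is well above y, where
   G(x) = (f(x) - rho) x / rho; and at most Lambda f(x) x / 2 whenever x >= y.
   The convergence is not uniform near the diagonal, where only one-sided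
   bounds are used.

   If rho <= f(phi_b)/2, the tangents of f to the right of phi_b give
   G(x) <= x0 := f^{-1}(2 rho) for x > x0, so that no deviation from x0 gains.
   If f(phi_b)/2 < rho, then f < 2 rho on [phi_L, phi_R]. The distribution
   function F of sigma^* solves t (1 - F(t)) + G(t) F(t) = phi_L, so against
   sigma^* every price earns at most e phi_L and those in [phi_L, phi_R] earn
   exactly that; shifting t by eta avoids the diagonal, F being Lipschitz. For
   the cycle, undercutting y by a small eta beats all prices at or above y, the
   nearby ones because Lambda f(x) / 2 < e. Played against the lower end point
   c of an interval [c, d], it therefore leaves [c, d] and beats all of it, so
   [c, d] fails condition (i) without margin. *)
Require Import Defs.
From HB Require Import structures.
From mathcomp Require Import all_boot all_order all_algebra.
From mathcomp Require Import all_classical all_reals all_analysis.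
From mathcomp Require Import measurable_realfun.
From mathcomp Require Import ring lra.
Import Order.TTheory GRing.Theory Num.Theory.
Import numFieldNormedType.Exports.
Local Open Scope classical_set_scope.
Local Open Scope ring_scope.

(** * The blocking probability *)

Section Queue.
Context {R : realType}.
Variables (e beta : R).
Hypotheses (e_gt0 : 0 < e) (beta_gt0 : 0 < beta).

Implicit Types mu nu : R.

Let e_ge0 : 0 <= e.
Proof. exact: ltW. Qed.
Let beta_ge0 : 0 <= beta.
Proof. exact: ltW. Qed.

Definition qterm (mu : R) (n : nat) : R :=
  e ^+ n / \prod_(1 <= a < n.+1) (mu + a%:R * beta).

Definition qsum (mu : R) : R := limn (series (qterm mu)).

Lemma qterm0 mu : qterm mu 0 = 1.
Proof. by rewrite /qterm expr0 big_nil invr1 mulr1. Qed.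

(** Splitting off the first factor shifts [mu] by [beta]; this is why the inductions on [n] below
    run over all [mu]. *)
Lemma qtermS mu n : qterm mu n.+1 = e / (mu + beta) * qterm (mu + beta) n.
Proof.
rewrite /qterm big_nat_recl//= mul1r exprS invfM mulrACA.
congr (_ * (_ / _)); by apply: eq_bigr => a _; rewrite -natr1 mulrDl mul1r addrAC addrA.
Qed.

Lemma qterm_ge0 mu n : 0 <= mu -> 0 <= qterm mu n.
Proof.
elim: n mu => [|n IHn] mu mu0; first by rewrite qterm0.
by rewrite qtermS mulr_ge0 ?IHn ?divr_ge0 ?addr_ge0.
Qed.

Lemma qterm_anti mu nu n : 0 <= mu -> mu <= nu -> qterm nu n <= qterm mu n.
Proof.
elim: n mu nu => [|n IHn] mu nu mu0 munu; first by rewrite !qterm0.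
rewrite !qtermS ler_pM//.
- by rewrite divr_ge0// addr_ge0// (le_trans mu0).
- by rewrite qterm_ge0// addr_ge0// (le_trans mu0).
- by rewrite ler_pM2l// lef_pV2 ?posrE ?lerD2r// ltr_wpDl// (le_trans mu0).
- by rewrite IHn ?lerD2r// addr_ge0.
Qed.

(** At [mu = 0] the product is beta^n n!, so the exponential series at [e / beta] dominates
    uniformly in [mu]. *)
Lemma qterm_le_exp mu n : 0 <= mu -> qterm mu n <= exp_coeff (e / beta) n.
Proof.
move=> mu0; apply: (le_trans (qterm_anti 0 mu n (lexx 0) mu0)).
rewrite /qterm /exp_coeff /= expr_div_n -mulrA ler_pM2l ?exprn_gt0// -invfM.
suff -> : \prod_(1 <= a < n.+1) (0 + a%:R * beta) = beta ^+ n * n`!%:R by [].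
elim: n => [|n IHn]; first by rewrite big_nil expr0 fact0 mul1r.
by rewrite big_nat_recr//= IHn add0r exprS factS natrM; ring.
Qed.

Lemma is_cvg_qsum mu : 0 <= mu -> cvgn (series (qterm mu)).
Proof.
move=> mu0; apply: (series_le_cvg _ _ _ (is_cvg_series_exp_coeff (e / beta))).
- by move=> n; exact: qterm_ge0.
- by move=> n; rewrite exp_coeff_ge0// divr_ge0.
- by move=> n; exact: qterm_le_exp.
Qed.

Lemma series_qtermS mu n :
  series (qterm mu) n.+1 = 1 + e / (mu + beta) * series (qterm (mu + beta)) n.
Proof.
rewrite /series /= big_nat_recl//= qterm0 mulr_sumr; congr (_ + _).
by apply: eq_bigr => i _; rewrite qtermS.
Qed.

Lemma series_qterm_ge0 mu n : 0 <= mu -> 0 <= series (qterm mu) n.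
Proof. by move=> mu0; apply: sumr_ge0 => i _; exact: qterm_ge0. Qed.

Lemma series_qterm_ge1 mu n : 0 <= mu -> 1 <= series (qterm mu) n.+1.
Proof.
move=> mu0; rewrite series_qtermS lerDl mulr_ge0 ?divr_ge0 ?addr_ge0//.
by rewrite series_qterm_ge0// addr_ge0.
Qed.

Lemma series_qterm_anti mu nu n : 0 <= mu -> mu <= nu ->
  series (qterm nu) n <= series (qterm mu) n.
Proof. by move=> mu0 munu; apply: ler_sum => i _; exact: qterm_anti. Qed.

(** Finite form of the throughput bound v <= e, needed in the next induction. With s_n the partial
    sums, it rests on mu / (mu + beta) <= 1 and s_n (mu + beta) <= s_n (mu) <= s_{n+1} (mu). *)
Lemma series_qterm_cap mu n : 0 <= mu ->
  mu * (series (qterm mu) n.+1 - 1) <= e * series (qterm mu) n.+1.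
Proof.
move=> mu0; have mb : 0 < mu + beta by rewrite ltr_wpDl.
rewrite {1}series_qtermS addrC addKr.
have -> : mu * (e / (mu + beta) * series (qterm (mu + beta)) n)
  = e * (mu / (mu + beta) * series (qterm (mu + beta)) n) by ring.
rewrite ler_pM2l//; apply: (@le_trans _ _ (series (qterm mu) n)).
  rewrite -[leRHS]mul1r; apply: ler_pM.
  - by rewrite divr_ge0// ltW.
  - by rewrite series_qterm_ge0// ltW.
  - by rewrite ler_pdivrMr// mul1r lerDl.
  - by rewrite series_qterm_anti// lerDl ltW.
by rewrite /series/= [leRHS]big_nat_recr//= lerDl qterm_ge0.
Qed.

(* Writing s_n for the partial sums, 1 / s_{n+1} (mu) = w / (w + e) with
   w = (mu + beta) / s_n (mu + beta): the Lipschitz bound on mu |-> mu / s_n mu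
   propagates from n to n + 1. *)
Lemma series_qterm_lip mu nu n : 0 <= mu -> mu <= nu ->
  nu / series (qterm nu) n.+1 - mu / series (qterm mu) n.+1 <= nu - mu.
Proof.
elim: n mu nu => [|n IHn] mu nu mu0 munu.
  by rewrite /series/= !big_nat1 !qterm0 !divr1.
have nu0 := le_trans mu0 munu.
rewrite !(series_qtermS _ n.+1).
have := IHn _ _ (addr_ge0 mu0 (ltW beta_gt0)) (lerD munu (lexx beta)).
have := series_qterm_cap _ n (addr_ge0 mu0 (ltW beta_gt0)).
have := series_qterm_ge1 _ n (addr_ge0 mu0 (ltW beta_gt0)).
have := series_qterm_ge1 _ n (addr_ge0 nu0 (ltW beta_gt0)).
set s := series _ n.+1; set t := series _ n.+1 => s1 t1 cap lip.
have mb : 0 < mu + beta by rewrite ltr_wpDl.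
have nb : 0 < nu + beta by rewrite ltr_wpDl.
have s0 : 0 < s by exact: lt_le_trans s1.
have t0 : 0 < t by exact: lt_le_trans t1.
move: lip cap.
have [a [a0 ->]] : exists a : R, 0 < a /\ s = (nu + beta) / a.
  by exists ((nu + beta) / s); split; [exact: divr_gt0|field; rewrite !gt_eqF].
have [b [b0 ->]] : exists b : R, 0 < b /\ t = (mu + beta) / b.
  by exists ((mu + beta) / t); split; [exact: divr_gt0|field; rewrite !gt_eqF].
have -> : (nu + beta) / ((nu + beta) / a) = a by field; rewrite !gt_eqF.
have -> : (mu + beta) / ((mu + beta) / b) = b by field; rewrite !gt_eqF.
have -> : (mu + beta) * ((mu + beta) / b - 1) =
  (mu + beta) / b * (mu + beta - b) by field; rewrite !gt_eqF.
rewrite [e * _]mulrC ler_pM2l ?divr_gt0// => lip cap.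
have -> : nu / (1 + e / (nu + beta) * ((nu + beta) / a)) = nu - nu * e / (a + e).
  by field; rewrite !gt_eqF// addr_gt0.
have -> : mu / (1 + e / (mu + beta) * ((mu + beta) / b)) = mu - mu * e / (b + e).
  by field; rewrite !gt_eqF// addr_gt0.
(* With denominators cleared, the difference of the sides is e times (nu - mu)(b + e - mu) + mu (nu
   - mu - (a - b)); [cap] makes b + e - mu positive. *)
suff : mu * e / (b + e) <= nu * e / (a + e) by lra.
rewrite ler_pdivrMr ?addr_gt0// mulrAC ler_pdivlMr ?addr_gt0//.
rewrite mulrAC [leRHS]mulrAC ler_pM2r//.
have h1 : 0 <= nu - mu by rewrite subr_ge0.
have h2 : 0 <= b + e - mu by have := beta_gt0; lra.
have h3 : 0 <= nu - mu - (a - b) by lra.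
have := mulr_ge0 h1 h2.
have := mulr_ge0 mu0 h3.
lra.
Qed.

Lemma qsum_rec mu : 0 <= mu ->
  qsum mu = 1 + e / (mu + beta) * qsum (mu + beta).
Proof.
move=> mu0; have nu0 : 0 <= mu + beta by exact: addr_ge0.
apply/cvg_lim => //; rewrite -cvg_shiftS.
rewrite (_ : (fun n => _) = fun n =>
    1 + e / (mu + beta) * series (qterm (mu + beta)) n); last first.
  by apply/funext => n; rewrite -series_qtermS.
apply: cvgD; first exact: cvg_cst.
by apply: cvgMr; exact: is_cvg_qsum.
Qed.

Lemma qsum_anti mu nu : 0 <= mu -> mu <= nu -> qsum nu <= qsum mu.
Proof.
move=> mu0 munu; apply: ler_lim; first exact/is_cvg_qsum/(le_trans mu0).
  exact: is_cvg_qsum.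
by apply: nearW => n; exact: series_qterm_anti.
Qed.

Lemma qsum_ge1 mu : 0 <= mu -> 1 <= qsum mu.
Proof.
move=> mu0; apply: limr_ge; first exact: is_cvg_qsum.
by exists 1%N => // -[//|n] _; exact: series_qterm_ge1.
Qed.

(** The stationary probability of the empty state in the birth-death chain with birth rate [e] and
    death rate [mu + a * beta] in state a. *)
Definition block mu : R := (qsum mu)^-1.

Lemma block_gt0 mu : 0 <= mu -> 0 < block mu.
Proof. by move=> mu0; rewrite invr_gt0 (lt_le_trans ltr01)// qsum_ge1. Qed.

Lemma block_le1 mu : 0 <= mu -> block mu <= 1.
Proof.
by move=> mu0; rewrite invf_le1 ?qsum_ge1// (lt_le_trans ltr01)// qsum_ge1.
Qed.

Lemma block_mono mu nu : 0 <= mu -> mu <= nu -> block mu <= block nu.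
Proof.
move=> mu0 munu; rewrite lef_pV2 ?qsum_anti// posrE -invr_gt0 block_gt0//.
exact: le_trans munu.
Qed.

(** The recursion for S, multiplied by (mu + beta) U(mu) U(mu + beta). *)
Lemma block_rec mu : 0 <= mu ->
  block mu * ((mu + beta) * block (mu + beta) + e) =
  (mu + beta) * block (mu + beta).
Proof.
move=> mu0; have := block_gt0 _ (addr_ge0 mu0 beta_ge0).
rewrite /block (qsum_rec mu)// invr_gt0 => s0.
have mb : 0 < mu + beta by rewrite ltr_wpDl.
field; rewrite !gt_eqF//= addr_gt0// mulr_gt0//.
Qed.

(** Limit of [series_qterm_lip]. As [mu * (1 - block mu)] is the throughput, the bound amounts to
    its monotonicity. *)
Lemma served_lip mu nu : 0 <= mu -> mu <= nu ->
  nu * block nu - mu * block mu <= nu - mu.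
Proof.
move=> mu0 munu; have nu0 := le_trans mu0 munu.
have h x : 0 <= x ->
    x / series (qterm x) n.+1 @[n --> \oo] --> x * block x.
  move=> x0; apply: cvgMr; apply: cvgV.
    by rewrite gt_eqF// (lt_le_trans ltr01)// qsum_ge1.
  by rewrite cvg_shiftS; exact: is_cvg_qsum.
have h2 : nu / series (qterm nu) n.+1 - mu / series (qterm mu) n.+1 @[n --> \oo]
    --> nu * block nu - mu * block mu by apply: cvgB; exact: h.
rewrite -(cvg_lim _ h2)//; apply: limr_le; first by apply/cvg_ex; eexists; exact: h2.
by apply: nearW => n; exact: series_qterm_lip.
Qed.

Lemma block_balance mu : 0 <= mu ->
  e * block mu = (mu + beta) * block (mu + beta) * (1 - block mu).
Proof. by move=> mu0; have := block_rec _ mu0; lra. Qed.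

(** Multiply by U(mu): since U(mu) <= U(mu + beta), the balance equation bounds the product by e
    U(mu). *)
Lemma served_cap mu : 0 <= mu -> mu * (1 - block mu) <= e.
Proof.
move=> mu0; have := block_balance _ mu0.
have mb : mu <= mu + beta by rewrite lerDl.
have := block_mono _ _ mu0 mb; have := block_gt0 _ mu0; have := block_le1 _ mu0.
have b0 := beta_gt0.
move: (block mu) (block (mu + beta)) => u u' u1 u0 uu' bal.
rewrite -(ler_pM2l u0) [leRHS]mulrC bal.
have : 0 <= beta * u' * (1 - u) by rewrite !mulr_ge0 ?subr_ge0//; lra.
have : 0 <= mu * (1 - u) * (u' - u) by rewrite !mulr_ge0 ?subr_ge0.
lra.
Qed.

(** By the Lipschitz bound (mu + beta) U(mu + beta) <= mu U(mu) + beta, so the balance equation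
    gives mu U(mu) (e - v) <= beta v for the throughput v, and v <= e. *)
Lemma served_defect mu : 0 <= mu ->
  mu * block mu * (e - mu * (1 - block mu)) <= beta * e.
Proof.
move=> mu0; have := block_balance _ mu0; have := served_cap _ mu0.
have mb : mu <= mu + beta by rewrite lerDl.
have := served_lip _ _ mu0 mb; have := block_gt0 _ mu0; have := block_le1 _ mu0.
have b0 := beta_gt0.
move: (block mu) (block (mu + beta)) => u u' u1 u0 lip cap bal.
have : 0 <= mu * (1 - u) * (mu * u + beta - (mu + beta) * u').
  by rewrite !mulr_ge0 ?subr_ge0//; lra.
have : 0 <= beta * (e - mu * (1 - u)) by rewrite mulr_ge0 ?subr_ge0.
have : mu * (e * u) = mu * ((mu + beta) * u' * (1 - u)) by rewrite bal.
lra.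
Qed.

(** For mu >= e the defect bound gives (e - v)^2 <= beta e, which is at most (theta e)^2. *)
Lemma served_heavy theta mu : 0 <= theta -> beta <= e * theta ^+ 2 -> e <= mu ->
  (1 - theta) * e <= mu * (1 - block mu).
Proof.
move=> th0 bth emu; have mu0 := le_trans e_ge0 emu.
have := served_defect _ mu0; have cap := served_cap _ mu0.
have -> : mu * block mu = mu - mu * (1 - block mu) by ring.
move: (mu * _) cap => v cap dfct.
have e0 := e_gt0.
suff : e - v <= e * theta by lra.
rewrite -ler_sqr ?nnegrE ?subr_ge0// ?mulr_ge0//.
apply: (@le_trans _ _ (beta * e)).
  by apply: le_trans dfct; rewrite expr2 ler_wpM2r ?subr_ge0// lerB.
by rewrite [leRHS]exprMn expr2 -mulrA mulrC ler_wpM2l.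
Qed.

Lemma block_light theta mu : 0 <= theta -> beta <= e * theta ^+ 2 ->
  0 <= mu <= e -> block mu <= theta.
Proof.
move=> th0 bth /andP[mu0 mue]; apply: (le_trans (block_mono _ _ mu0 mue)).
have := served_heavy _ _ th0 bth (lexx e).
by rewrite mulrC ler_pM2l// lerD2l lerN2.
Qed.

(** Subtracting two balance equations, with w = (mu + beta) U(mu + beta) and w' its value at nu,
    leaves (w' - w)(1 - U(mu)) minus a nonnegative term. This serves the continuity of the split
    condition. *)
Lemma block_lip mu nu : 0 <= mu -> mu <= nu ->
  e * (block nu - block mu) <= nu - mu.
Proof.
move=> mu0 munu; have nu0 := le_trans mu0 munu.
have b0 := beta_gt0.
have mb0 := addr_ge0 mu0 beta_ge0; have nb0 := addr_ge0 nu0 beta_ge0.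
have := served_lip _ _ mb0 (lerD munu (lexx beta)).
rewrite mulrBr !block_balance//.
have := block_mono _ _ mu0 munu.
have := block_gt0 _ mu0; have := block_le1 _ mu0.
have := mulr_ge0 nb0 (ltW (block_gt0 _ nb0)).
move: (_ * block (nu + beta)) (_ * block (mu + beta)) => w' w w0'.
move: (block mu) (block nu) => u u' u1 u0 uu' lip.
have : 0 <= w' * (u' - u) by rewrite mulr_ge0 ?subr_ge0.
have : 0 <= (nu - mu - (w' - w)) * (1 - u) by rewrite mulr_ge0; lra.
have : 0 <= (nu - mu) * u by rewrite mulr_ge0 ?subr_ge0// ltW.
lra.
Qed.

(** If U(mu) = U(nu) < 1, the balance equations force (mu + beta) U(mu + beta) = (nu + beta) U(nu +
    beta), yet this product increases strictly. *)
Lemma block_smono mu nu : 0 <= mu -> mu < nu -> block mu < block nu.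
Proof.
move=> mu0 munu; have nu0 := ltW (le_lt_trans mu0 munu).
rewrite lt_neqAle block_mono ?(ltW munu)// andbT; apply/eqP => E.
have := block_balance _ nu0; rewrite -E block_balance//.
have mb0 := addr_ge0 mu0 beta_ge0.
have u1 : block mu < 1.
  rewrite lt_neqAle block_le1// andbT; apply/eqP => u1.
  have := block_balance _ mu0; rewrite u1 subrr mulr0 mulr1 => e0.
  by move: e_gt0; rewrite e0 ltxx.
have u10 : 1 - block mu != 0 by rewrite gt_eqF// subr_gt0.
move=> /(mulIf u10) /eqP; rewrite lt_eqF//.
apply: (@lt_le_trans _ _ ((nu + beta) * block (mu + beta))).
  by rewrite ltr_pM2r ?ltrD2r ?block_gt0.
by rewrite ler_pM2l ?block_mono ?lerD2r// ?ltW// ltr_wpDl.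
Qed.
End Queue.

(** * The Wardrop split *)

Lemma lipschitz_within_continuous (R : realType) (A : set R) (g : R -> R) (k : R) :
  (forall x y, A x -> A y -> x <= y -> `|g y - g x| <= k * (y - x)) ->
  {within A, continuous g}.
Proof.
move=> gk; apply/subspace_continuousP => x Ax; apply/cvgrPdist_le => d d0.
have k0 : 0 < `|k| + 1 by rewrite ltr_wpDl.
rewrite near_withinE; near=> y => Ay.
have xy : `|x - y| <= d / (`|k| + 1).
  by near: y; apply: cvgr_dist_le; [exact: cvg_id|rewrite divr_gt0].
move: xy; rewrite ler_pdivlMr// => /(le_trans _); apply.
have kk := ler_norm k; have kn := normr_ge0 k.
have [yx|/ltW xy] := leP y x.
  apply: le_trans (gk _ _ Ay Ax yx) _.
  by rewrite ger0_norm ?subr_ge0// mulrC ler_wpM2l ?subr_ge0//; lra.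
rewrite distrC [`|x - y|]distrC.
apply: le_trans (gk _ _ Ax Ay xy) _.
by rewrite ger0_norm ?subr_ge0// mulrC ler_wpM2l ?subr_ge0//; lra.
Unshelve. all: by end_near. Qed.

(** The three conditions say that the point is the zero of [D], or the end point closest to one.
    Such a point exists by the intermediate value theorem, and strict monotonicity makes it the only
    minimizer of the square, so [xget] returns it. *)
Lemma argmin_sqr_kkt (R : realType) (L : R) (D : R -> R) : 0 < L ->
  {within `[0, L], continuous D} ->
  (forall x y, 0 <= x -> x < y -> y <= L -> D x < D y) ->
  let l := argmin_on `[0, L]%classic (fun x => D x ^+ 2) in
  [/\ 0 <= l <= L, 0 < l -> D l <= 0 & l < L -> 0 <= D l].
Proof.
move=> L0 cD incD.
pose kkt x := [/\ 0 <= x <= L, 0 < x -> D x <= 0 & x < L -> 0 <= D x].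
have [x0 kx0] : exists x, kkt x.
  have [D0|D0] := leP 0 (D 0).
    by exists 0; split => //; [rewrite lexx ltW|rewrite ltxx].
  have [DL|DL] := leP (D L) 0.
    by exists L; split => //; [rewrite lexx ltW|rewrite ltxx].
  have [|x] := @IVT _ D 0 L 0 (ltW L0) cD.
    by rewrite ge_min le_max (ltW D0) (ltW DL) orbT.
  by rewrite in_itv/= => xL Dx; exists x; split; rewrite ?Dx.
have kktlt x y : kkt x -> 0 <= y <= L -> y != x -> D x ^+ 2 < D y ^+ 2.
  move=> [/andP[x00 xL] kx1 kx2] /andP[y0 yL]; rewrite neq_lt => /orP[] h.
    have := incD _ _ y0 h xL; have := kx1 (le_lt_trans y0 h).
    by rewrite -(sqrrN (D x)) -(sqrrN (D y)) => ? ?; rewrite ltr_sqr ?nnegrE; lra.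
  have := incD _ _ x00 h yL; have := kx2 (lt_le_trans h yL).
  by move=> ? ?; rewrite ltr_sqr ?nnegrE; lra.
rewrite /argmin_on (_ : xget 0 _ = x0)//.
have [x0L _ _] := kx0.
apply: xget_unique => /=.
  split; first by rewrite in_itv.
  move=> y; rewrite in_itv/= => yL.
  by have [->//|/(kktlt _ _ kx0 yL)/ltW] := eqVneq y x0.
move=> y []; rewrite in_itv/= => yL /(_ x0); rewrite in_itv/= => /(_ x0L).
by have [->//|/(kktlt _ _ kx0 yL)] := eqVneq y x0; rewrite ltNge => /negP.
Qed.

Section Wardrop.
Context {R : realType}.
Variables (e beta : R).
Hypotheses (e_gt0 : 0 < e) (beta_gt0 : 0 < beta).
Implicit Types a b l m : R.

Let e_ge0 : 0 <= e.
Proof. exact: ltW. Qed.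

(* With a = f phi, this is 1 - B(phi, l). *)
Definition accept a l : R := a * (1 - block e beta (l * a)).

Lemma accept_anti a l m : 0 < a -> 0 <= l -> l < m -> accept a m < accept a l.
Proof.
move=> a0 l0 lm; rewrite /accept ltr_pM2l// ltrD2l ltrN2.
by rewrite block_smono ?ltr_pM2r// mulr_ge0// ltW.
Qed.

Lemma accept_bounds a l : 0 < a -> 0 <= l ->
  0 <= accept a l <= a /\ l * accept a l <= e.
Proof.
move=> a0 l0; have la := mulr_ge0 l0 (ltW a0); split.
  apply/andP; split; first by rewrite mulr_ge0 ?subr_ge0 ?block_le1// ltW.
  by rewrite /accept -[leRHS]mulr1 ler_pM2l// gerBl ltW// block_gt0.
by rewrite mulrA served_cap.
Qed.

(** The alternative is whether the load [l * a] stays below the capacity [e] or exceeds it. *)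
Lemma accept_alt theta a l : 0 < a -> 0 <= l -> 0 <= theta ->
  beta <= e * theta ^+ 2 ->
  (1 - theta) * a <= accept a l \/ (1 - theta) * e <= l * accept a l.
Proof.
move=> a0 l0 th0 bth; have la := mulr_ge0 l0 (ltW a0).
have [h|/ltW h] := leP (l * a) e.
  left; rewrite /accept [leRHS]mulrC ler_pM2r// lerD2l lerN2.
  by apply: (@block_light _ e) => //; rewrite la.
by right; rewrite mulrA served_heavy.
Qed.

(** For [l > 0], [l * accept a l] is the throughput at load [l * a], which is monotone. *)
Lemma accept_mono a b l : 0 < a -> a <= b -> 0 <= l -> accept a l <= accept b l.
Proof.
move=> a0 ab; rewrite le_eqVlt => /orP[/eqP<-|l0].
  rewrite /accept !mul0r ler_wpM2r// subr_ge0 block_le1//.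
rewrite -(ler_pM2l l0) /accept.
have la : 0 <= l * a by rewrite mulr_ge0 ?ltW.
have lab : l * a <= l * b by rewrite ler_pM2l.
by have := served_lip _ _ e_gt0 beta_gt0 _ _ la lab; lra.
Qed.

Lemma accept_lip a l m : 0 < a -> 0 <= l -> l <= m ->
  `|accept a m - accept a l| <= a ^+ 2 / e * (m - l).
Proof.
move=> a0 l0 lm.
rewrite ler0_norm; last first.
  have [->|?] := eqVneq l m; rewrite ?subrr// subr_le0 ltW// accept_anti//.
  by rewrite lt_neqAle lm andbT.
rewrite -(ler_pM2l e_gt0).
have -> : e * (a ^+ 2 / e * (m - l)) = a * (m * a - l * a).
  by field; rewrite gt_eqF.
have -> : e * - (accept a m - accept a l) =
    a * (e * (block e beta (m * a) - block e beta (l * a))).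
  by rewrite /accept; ring.
have la : 0 <= l * a by rewrite mulr_ge0// ltW.
by rewrite ler_pM2l// block_lip// ler_pM2r.
Qed.

Variables (Lam : R) (f : R -> R).
Hypothesis Lam_gt0 : 0 < Lam.

(** The difference of the two B's is a difference of acceptance probabilities, strictly increasing
    in the load of the first platform. The result is Wardrop's principle: a platform in use accepts
    at least as often as the other. *)
Lemma wardrop_kkt (p : R * R) : 0 < f p.1 -> 0 < f p.2 ->
  let l := wardrop f Lam e beta p in
  [/\ 0 <= l <= Lam,
      0 < l -> accept (f p.2) (Lam - l) <= accept (f p.1) l &
      l < Lam -> accept (f p.1) l <= accept (f p.2) (Lam - l)].
Proof.
move: p => [x y] /= a0 b0.
pose D l := accept (f y) (Lam - l) - accept (f x) l.
have := @argmin_sqr_kkt _ Lam D Lam_gt0.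
have -> : argmin_on `[0, Lam]%classic (fun l => D l ^+ 2) =
    wardrop f Lam e beta (x, y).
  rewrite /wardrop; congr argmin_on; apply/funext => l; congr (_ ^+ 2).
  by rewrite /D /accept /calB /calU /block /qsum /qterm/=; ring.
move: (wardrop f Lam e beta (x, y)) => l; rewrite /D /= => kkt.
have [||lL k1 k2] := kkt.
- apply: (@lipschitz_within_continuous _ _ _ ((f y) ^+ 2 / e + (f x) ^+ 2 / e)).
  move=> l1 l2 /=; rewrite !in_itv/= => /andP[l10 l1L] /andP[l20 l2L] l12.
  have l1L' : 0 <= Lam - l2 by rewrite subr_ge0.
  have l12' : Lam - l2 <= Lam - l1 by rewrite lerD2l lerN2.
  have h1 := accept_lip _ _ _ b0 l1L' l12'.
  have h2 := accept_lip _ _ _ a0 l10 l12.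
  have -> (A B C D' : R) : A - B - (C - D') = - ((C - A) + (B - D')) by ring.
  rewrite normrN; apply: (le_trans (ler_normD _ _)); rewrite mulrDl lerD//.
  by move: h1; rewrite (_ : Lam - l1 - (Lam - l2) = l2 - l1)//; ring.
- move=> l1 l2 l10 l12 l2L; apply: ltrB; apply: accept_anti => //.
  + by rewrite subr_ge0.
  + by rewrite ltrD2l ltrN2.
split=> // h; first by rewrite -subr_le0 k1.
by rewrite -subr_ge0 k2.
Qed.
End Wardrop.

(** * Payoff bounds *)

(* Bounds on the payoff of the player at price x against y, in which beta only
   enters through theta; theta = 0 is the game in the limit beta -> 0. *)
Record near_limit {R : realType} (h : R) (f : R -> R) (Lam e theta : R)
    (M : player -> R * R -> R) : Prop := NearLimit {
  payoff_ge0 : forall i x y, x \in `[0, h] -> y \in `[0, h] ->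
    0 <= M i (profile i x y);
  payoff_cap : forall i x y, x \in `[0, h] -> y \in `[0, h] ->
    M i (profile i x y) <= e * x;
  payoff_undercut : forall i x y, x \in `[0, h] -> y \in `[0, h] ->
    f y < (1 - theta) * f x -> e <= Lam * f x ->
    (1 - theta) * e * x <= M i (profile i x y);
  payoff_floor : forall i x y, x \in `[0, h] -> y \in `[0, h] ->
    (1 - theta) * Lam * f x - e <= (1 - theta) * e ->
    ((1 - theta) * Lam * f x - e) * x <= M i (profile i x y);
  payoff_floor_rich : forall i x y, x \in `[0, h] -> y \in `[0, h] ->
    2 * e <= Lam * f x -> (1 - 2 * theta) * e * x <= M i (profile i x y);
  payoff_overpriced : forall i x y, x \in `[0, h] -> y \in `[0, h] ->
    f x < (1 - theta) * f y ->
    M i (profile i x y) <= Num.max 0 (Lam * f x - (1 - theta) * e) * x;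
  payoff_higher : forall i x y, x \in `[0, h] -> y \in `[0, h] -> y <= x ->
    M i (profile i x y) <= Lam * f x / 2 * x }.

Section PayoffBounds.
Context {R : realType}.
Variables (h : R) (f : R -> R) (Lam e beta theta : R).
Hypotheses (f_decr : strictly_decreasing_on `[0, h]%classic f)
  (f_gt0 : forall x, x \in `[0, h] -> 0 < f x)
  (Lam_gt0 : 0 < Lam) (e_gt0 : 0 < e) (beta_gt0 : 0 < beta)
  (theta_bnd : 0 <= theta < 1) (beta_theta : beta <= e * theta ^+ 2).

Lemma load_kkt i x y : 0 < f x -> 0 < f y ->
  let l := load f Lam e beta i (profile i x y) in
  let P := accept e beta (f x) l in let Q := accept e beta (f y) (Lam - l) in
  [/\ 0 <= l <= Lam, 0 < l -> Q <= P & l < Lam -> P <= Q].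
Proof.
move=> x0 y0; case: i => /=.
  have := @wardrop_kkt R e beta e_gt0 beta_gt0 Lam f Lam_gt0 (x, y) x0 y0.
  by case.
have := @wardrop_kkt R e beta e_gt0 beta_gt0 Lam f Lam_gt0 (y, x) y0 x0.
move: (wardrop _ _ _ _ _) => /= w [/andP[w0 wL] k1 k2].
rewrite subKr; split.
- by rewrite subr_ge0 wL gerBl.
- by rewrite subr_gt0.
- by rewrite gtrBl.
Qed.

Lemma payoff_accept i x y : let l := load f Lam e beta i (profile i x y) in
  payoff f Lam e beta i (profile i x y) = l * accept e beta (f x) l * x.
Proof.
rewrite /payoff (_ : Defs.coord i (profile i x y) = x); last by case: i.
by rewrite /accept /calU /block /qsum /qterm /=; ring.
Qed.

Lemma payoff_bounds i x y : x \in `[0, h] -> y \in `[0, h] ->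
  exists l P Q,
  [/\ payoff f Lam e beta i (profile i x y) = l * P * x,
      [/\ 0 <= l <= Lam, 0 < l -> Q <= P & l < Lam -> P <= Q],
      0 <= P <= f x /\ l * P <= e, 0 <= Q <= f y /\ (Lam - l) * Q <= e &
      [/\ (1 - theta) * f x <= P \/ (1 - theta) * e <= l * P,
      (1 - theta) * f y <= Q \/ (1 - theta) * e <= (Lam - l) * Q &
      y <= x -> l <= Lam / 2]].
Proof.
move=> xh yh; have x0 := f_gt0 _ xh; have y0 := f_gt0 _ yh.
have := load_kkt i x y x0 y0; rewrite payoff_accept.
move: (load _ _ _ _ _ _) => l /= kkt.
have [lL k1 k2] := kkt; have /andP[l0 lL'] := lL.
have m0 : 0 <= Lam - l by rewrite subr_ge0.
have th0 : 0 <= theta by case/andP: theta_bnd.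
exists l, (accept e beta (f x) l), (accept e beta (f y) (Lam - l)); split => //.
- exact: accept_bounds.
- exact: accept_bounds.
split; [exact: accept_alt|exact: accept_alt|].
(* With more than half the load and no greater demand, x would accept strictly less often than y,
   against the split condition. *)
rewrite le_eqVlt => yx; rewrite leNgt; apply/negP => lL2.
have fxy : f x <= f y.
  by case/orP: yx => [/eqP->//|yx]; apply/ltW/f_decr.
have L0 := Lam_gt0.
have lm : Lam - l < l by lra.
have := k1 (le_lt_trans m0 lm); rewrite leNgt => /negP; apply.
apply: (lt_le_trans (accept_anti _ _ e_gt0 beta_gt0 _ _ _ x0 m0 lm)).
exact: accept_mono.
Qed.

(* The other platform serves at most e, and at a rate P when both are used. *)
Let share l P Q : 0 <= l -> l <= Lam -> (0 < l -> Q <= P) -> (l < Lam -> P <= Q) ->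
  (Lam - l) * Q <= e -> 0 <= P -> Lam * P - e <= l * P.
Proof.
have e0 := e_gt0; have L0 := Lam_gt0.
move=> l0 lL k1 k2 mQ P0; have [lL'|lL'] := ltP l Lam; last first.
  have -> : l = Lam by apply/eqP; rewrite eq_le lL.
  by lra.
have PQ := k2 lL'.
have : 0 <= (Lam - l) * (Q - P) by rewrite mulr_ge0 ?subr_ge0.
lra.
Qed.

Lemma payoff_near_limit : near_limit h f Lam e theta (payoff f Lam e beta).
Proof.
have e0 := e_gt0; have L0 := Lam_gt0; have /andP[th0 th1] := theta_bnd.
have x0 (x : R) : x \in `[0, h] -> 0 <= x by rewrite in_itv/= => /andP[].
split=> i x y xh yh; have fx0 := f_gt0 _ xh; have fy0 := f_gt0 _ yh;
  have {x0} x0 := x0 _ xh;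
  have [l [P [Q [-> [/andP[l0 lL] k1 k2]
    [/andP[P0 Pa] lP] [/andP[Q0 Qb] mQ] [aP aQ yx]]]]] := payoff_bounds i x y xh yh.
- by rewrite !mulr_ge0.
- by rewrite ler_wpM2r.
- move=> gap efx; rewrite ler_wpM2r//.
  case: aP => // aP; have [lL'|lL'] := ltP l Lam; first by have := k2 lL'; lra.
  have -> : l = Lam by apply/eqP; rewrite eq_le lL.
  have : 0 <= (1 - theta) * (Lam * f x - e) by rewrite mulr_ge0 ?subr_ge0// ltW.
  have : 0 <= Lam * (P - (1 - theta) * f x) by rewrite mulr_ge0 ?subr_ge0// ltW.
  lra.
- move=> flo; rewrite ler_wpM2r//; case: aP => [aP|]; last exact: le_trans.
  have : 0 <= Lam * (P - (1 - theta) * f x) by rewrite mulr_ge0 ?subr_ge0// ltW.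
  by have := share l P Q l0 lL k1 k2 mQ P0; lra.
- move=> rich; rewrite ler_wpM2r//; case: aP => aP; last by have := mulr_ge0 th0 (ltW e0); lra.
  have : 0 <= Lam * (P - (1 - theta) * f x) by rewrite mulr_ge0 ?subr_ge0// ltW.
  have : 0 <= (1 - theta) * (Lam * f x - 2 * e) by rewrite mulr_ge0 ?subr_ge0// ltW.
  by have := share l P Q l0 lL k1 k2 mQ P0; lra.
(* A platform in use has Q <= P <= f x < (1 - theta) f y, so the rival is saturated: (Lam - l) Q >=
   (1 - theta) e, and l P = Lam P - (Lam - l) P. *)
- move=> gap; rewrite ler_wpM2r// le_max.
  move: l0; rewrite le_eqVlt => /orP[/eqP<-|l0]; first by rewrite mul0r lexx.
  have QP := k1 l0; case: aQ => aQ; first by lra.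
  have : 0 <= (Lam - l) * (P - Q) by rewrite mulr_ge0 ?subr_ge0.
  have : 0 <= Lam * (f x - P) by rewrite mulr_ge0 ?subr_ge0// ltW.
  by move=> ? ?; apply/orP; right; lra.
- move=> /yx l2; rewrite ler_wpM2r//.
  have : 0 <= (Lam / 2 - l) * P by rewrite mulr_ge0 ?subr_ge0.
  have : 0 <= Lam * (f x - P) by rewrite mulr_ge0 ?subr_ge0// ltW.
  lra.
Qed.
End PayoffBounds.

(** * Integration *)

Lemma probability_of_cdf (R : realType) (F : R -> R) :
  nondecreasing F -> right_continuous F ->
  F x @[x --> -oo] --> (0 : R) -> F x @[x --> +oo] --> (1 : R) ->
  exists P : probability R R, forall t, P `]-oo, t]%classic = (F t)%:E.
Proof.
move=> nd rc Ny y.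
pose F' : cumulativeBounded (0 : R) (1 : R) :=
  HB.pack F (isCumulative.Build _ _ _ F nd rc)
    (isCumulativeBounded.Build _ _ _ F Ny y).
pose lsf : probability (measurableTypeR R) R := lebesgue_stieltjes_measure F'.
(* The image under the identity carries the Lebesgue-Stieltjes measure from [measurableTypeR R] to
   [R]. *)
pose X : {mfun measurableTypeR R >-> R} :=
  HB.pack (idfun : measurableTypeR R -> R)
    (isMeasurableFun.Build _ _ _ _ (idfun : measurableTypeR R -> R)
      (@measurable_id _ _ setT)).
exists (distribution lsf X) => t.
exact: (@cdf_lebesgue_stieltjes_id R F' t).
Qed.

Section MeasureLemmas.
Context {R : realType}.
Local Open Scope ereal_scope.

(* The integral of a nonnegative function is a supremum over the simple
   functions below it; this is what allows payoffs whose measurability is not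
   established. *)
Lemma integral_mono_ge0 d (T : measurableType d) (mu : {measure set T -> \bar R})
  (D E : set T) (g1 g2 : T -> \bar R) : D `<=` E ->
  (forall x, E x -> 0 <= g2 x) -> (forall x, D x -> 0 <= g1 x <= g2 x) ->
  \int[mu]_(x in D) g1 x <= \int[mu]_(x in E) g2 x.
Proof.
move=> DE g20 g12; rewrite integral_mkcond [leRHS]integral_mkcond.
rewrite !ge0_integralTE; last 2 first.
- by move=> x; exact: erestrict_ge0.
- by move=> x; apply: erestrict_ge0 => y Dy; have /andP[] := g12 _ Dy.
apply: ereal_sup_le => _ [k /= kg <-]; exists k => // x.
apply: (le_trans (kg x)); rewrite /patch; case: ifPn => xD.
  by rewrite (mem_set (DE _ (set_mem xD))); have /andP[] := g12 _ (set_mem xD).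
by case: ifPn => // xE; exact/g20/set_mem.
Qed.

Lemma integral_step (P : probability R R) (t a b q : R) :
  (0 <= a)%R -> (0 <= b)%R -> P `]-oo, t]%classic = q%:E ->
  \int[P]_y (if (y <= t)%R then a else b)%:E = (a * q + b * (1 - q))%:E.
Proof.
move=> a0 b0 Pt.
have mt : measurable (`]-oo, t]%classic : set R) by exact: measurable_itv.
have PC : P (~` `]-oo, t]%classic) = (1 - q)%:E.
  by rewrite probability_setC// Pt EFinB.
transitivity (\int[P]_y (a%:E * (\1_(`]-oo, t]%classic) y)%:E +
    b%:E * (\1_(~` `]-oo, t]%classic) y)%:E)).
  apply: eq_integral => y _; rewrite -!EFinM -EFinD !indicE; congr (_%:E).
  rewrite in_setC !mem_setE in_itv/=.
  by case: (y <= t)%R; rewrite ?mulr0 ?mulr1 ?addr0 ?add0r.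
rewrite ge0_integralD//=; last 4 first.
- by move=> y _; rewrite -EFinM lee_fin mulr_ge0.
- by apply/measurable_EFinP/measurable_funM => //; exact: measurable_indic.
- by move=> y _; rewrite -EFinM lee_fin mulr_ge0.
- apply/measurable_EFinP/measurable_funM => //; apply: measurable_indic.
  exact: measurableC.
rewrite !ge0_integralZl_EFin//; last 2 first.
- by apply/measurable_EFinP/measurable_indic/measurableC.
- by apply/measurable_EFinP/measurable_indic.
rewrite !integral_indic//; last exact: measurableC.
have fin X Y : X = q%:E -> Y = (1 - q)%:E ->
  a%:E * X + b%:E * Y = (a * q + b * (1 - q))%:E by move=> -> ->.
by rewrite !setIT; exact: fin.
Qed.

Lemma measurable_step (t a b : R) :
  measurable_fun [set: R] (fun y : R => (if (y <= t)%R then a else b)%:E).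
Proof.
apply/measurable_EFinP/measurable_fun_ifT => //.
by apply: measurable_fun_ler => //.
Qed.

Lemma integral_full (P : probability R R) (A : set R) (g : R -> \bar R) :
  measurable A -> P A = 1 -> measurable_fun setT g -> (forall x, 0 <= g x) ->
  \int[P]_(x in A) g x = \int[P]_x g x.
Proof.
have PC : P A = 1 -> measurable A -> P (~` A) = 0.
  by move=> PA mA; rewrite probability_setC// PA subee.
move=> mA PA mg g0; rewrite (@ge0_negligible_integral _ _ _ _ setT (~` A))//.
- by rewrite setDE setCK setTI.
- exact: measurableC.
- exact: (PC PA mA).
Qed.

Lemma integral_profile (P : probability R R) i (g : R * R -> \bar R) :
  measurable_fun setT g -> (forall p, 0 <= g p) ->
  \int[P \x P]_p g p = \int[P]_x \int[P]_y g (profile i x y).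
Proof.
move=> mg g0; apply: (etrans (fubini_tonelli1 _ mg g0)); case: i; first by [].
exact: (fubini_tonelli _ mg g0).
Qed.

(** The integrand is bounded below by a function that, for fixed own price x, is a step in y: [lo x]
    up to [x + eta], [hi x] beyond. Monotonicity of [lo] and [hi] makes it measurable, so Tonelli
    applies to it although it need not apply to [g]. *)
Lemma integral_square_ge (P : probability R R) (A D : set R) i (g : R * R -> R)
    (F lo hi : R -> R) (eta c : R) :
  measurable A -> A `<=` D -> P A = 1 ->
  (forall t, P `]-oo, t]%classic = (F t)%:E) ->
  (forall x y, D x -> D y -> 0 <= g (profile i x y))%R ->
  {homo lo : x y / (x <= y)%R} -> {homo hi : x y / (x <= y)%R} ->
  (forall x, 0 <= lo x)%R -> (forall x, 0 <= hi x)%R ->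
  (forall x y, A x -> A y -> lo x <= g (profile i x y))%R ->
  (forall x y, A x -> A y -> x + eta < y -> hi x <= g (profile i x y))%R ->
  (forall x, A x -> c <= lo x * F (x + eta) + hi x * (1 - F (x + eta)))%R ->
  c%:E <= \int[P \x P]_(p in D `*` D) (g p)%:E.
Proof.
move=> mA AD PA PF g0 mlo mhi lo0 hi0 glo ghi hc.
have g0' p : (D `*` D) p -> (0 <= g p)%R.
  by case: p => x y [/= Dx Dy]; case: i g0 {glo ghi} => g0; exact: g0.
have [c0|/ltW c0] := leP 0%R c; last first.
  by apply: (@le_trans _ _ 0); [rewrite lee_fin|apply: integral_ge0].
pose step x y : R := if (y <= x + eta)%R then lo x else hi x.
have step0 x y : (0 <= step x y)%R by rewrite /step; case: ifP.
pose u p := (step (Defs.coord i p) (Defs.coord (other i) p))%:E.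
have uE x y : u (profile i x y) = (step x y)%:E by rewrite /u; case: i {g0 glo ghi u}.
have mu : measurable_fun setT u.
  apply/measurable_EFinP; rewrite /step.
  have mc j : measurable_fun setT (Defs.coord j : R * R -> R).
    by case: j; [exact: measurable_fst|exact: measurable_snd].
  apply: measurable_fun_ifT.
  - by apply: measurable_fun_ler; [exact: mc|apply: measurable_funD; [exact: mc|]].
  - apply: (measurableT_comp _ (mc i)); exact: nondecreasing_measurable.
  - apply: (measurableT_comp _ (mc i)); exact: nondecreasing_measurable.
have mAA : measurable (A `*` A) by exact: measurableX.
apply: (@le_trans _ _ (\int[P \x P]_(p in A `*` A) u p)); last first.
  apply: integral_mono_ge0.
  - by move=> [x y] [/= Ax Ay]; split; exact: AD.
  - by move=> p Dp; rewrite lee_fin g0'.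
  - move=> p Ap; rewrite !lee_fin step0/=.
    have : A (Defs.coord i p) /\ A (Defs.coord (other i) p).
      by case: p Ap {g0' u uE mu} => x y [/= Ax Ay]; case: i {g0 glo ghi}.
    have -> : g p = g (profile i (Defs.coord i p) (Defs.coord (other i) p)).
      by case: p {Ap} => x y; case: i {g0 glo ghi u uE mu}.
    move=> [A1 A2]; rewrite /step; case: ifPn => [_|]; first exact: glo.
    by rewrite -ltNge => /ghi; exact.
rewrite integral_mkcond (integral_profile _ i)//; last 2 first.
- exact/(measurable_restrictT _ _).1/measurable_funTS.
- by move=> p; apply: erestrict_ge0 => q _; rewrite lee_fin.
have cA : c%:E = \int[P]_(x in A) (cst c%:E) x.
  have fin X : X = 1 -> c%:E = c%:E * X by move=> ->; rewrite mule1.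
  by rewrite integral_cst//; exact: fin.
rewrite cA; apply: integral_mono_ge0 => //.
  by move=> x _; apply: integral_ge0 => y _; apply: erestrict_ge0 => q _; rewrite lee_fin.
move=> x Ax; rewrite /= lee_fin c0/=.
apply: (@le_trans _ _ (\int[P]_(y in A) (step x y)%:E)); last first.
  rewrite integral_mkcond le_eqVlt; apply/orP; left; apply/eqP.
  apply: eq_integral => y _; rewrite /patch uE.
  suff -> : (profile i x y \in A `*` A) = (y \in A) by [].
  apply/idP/idP => /set_mem h; apply/mem_set.
    by case: i h {g0 glo ghi u uE mu} => -[].
  by case: i {g0 glo ghi u uE mu}; split.
have PFx := PF (x + eta)%R.
rewrite integral_full//; last 2 first.
- exact: measurable_step.
- by move=> y; rewrite lee_fin.
by rewrite (integral_step _ _ _ _ (F (x + eta)%R))// lee_fin hc.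
Qed.

Lemma integral_step_le (P : probability R R) (D : set R) (g : R -> R) (t a b q : R) :
  (0 <= a)%R -> (0 <= b)%R -> P `]-oo, t]%classic = q%:E ->
  (forall y, D y -> 0 <= g y)%R ->
  (forall y, D y -> y <= t -> g y <= a)%R -> (forall y, D y -> g y <= b)%R ->
  \int[P]_(y in D) (g y)%:E <= (a * q + b * (1 - q))%:E.
Proof.
move=> a0 b0 Pt g0 ga gb; rewrite -(integral_step _ _ _ _ _ a0 b0 Pt).
apply: integral_mono_ge0 => //.
  by move=> y _; rewrite lee_fin; case: ifP.
by move=> y Dy; rewrite !lee_fin g0//=; case: ifP => [/ga|_]; [exact|exact: gb].
Qed.
End MeasureLemmas.

(** * Equilibria for a concave demand *)

Section ConcaveDemand.
Context {R : realType}.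
Variables (h : R) (f : R -> R).
Hypotheses (h_gt0 : 0 < h)
  (f_concave : strictly_concave_on `[0, h]%classic f)
  (f_decr : strictly_decreasing_on `[0, h]%classic f)
  (f_diff : forall x, x \in `[0, h] -> derivable_within `[0, h]%classic f x)
  (f_bounds : forall x, x \in `[0, h] -> 0 < f x <= 1)
  (f0 : f 0 = 1).
Implicit Types x y z t : R.

Lemma concave_lt x y z : 0 <= x -> x < y -> y < z -> z <= h ->
  f x * (z - y) + f z * (y - x) < f y * (z - x).
Proof.
move=> x0 xy yz zh; have xz := lt_trans xy yz.
have zx : 0 < z - x by rewrite subr_gt0.
have := f_concave x z ((z - y) / (z - x)); rewrite /= !in_itv/=.
rewrite x0 zh (ltW (le_lt_trans x0 xz)) (ltW (lt_le_trans xz zh)) lt_eqF//.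
rewrite divr_gt0 ?subr_gt0//= ltr_pdivrMr// mul1r ltrD2l ltrN2 xy => /(_ isT isT isT isT).
have -> : (z - y) / (z - x) * x + (1 - (z - y) / (z - x)) * z = y.
  by field; rewrite gt_eqF.
have -> : (z - y) / (z - x) * f x + (1 - (z - y) / (z - x)) * f z =
    (f x * (z - y) + f z * (y - x)) / (z - x).
  by field; rewrite gt_eqF.
by rewrite ltr_pdivrMr.
Qed.

Lemma concave_le x y z : 0 <= x -> x <= y -> y <= z -> z <= h ->
  f x * (z - y) + f z * (y - x) <= f y * (z - x).
Proof.
move=> x0; rewrite le_eqVlt => /orP[/eqP<- _ _|xy]; first by lra.
rewrite le_eqVlt => /orP[/eqP-> _|yz zh]; first by lra.
exact/ltW/concave_lt.
Qed.

Lemma demand_lt x y : 0 <= x -> x < y -> y <= h -> f y < f x.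
Proof.
move=> x0 xy yh; apply: f_decr => //=; rewrite in_itv/= ?x0 ?yh ?andbT.
  by rewrite (le_trans (ltW xy)).
by rewrite (le_trans x0)// ltW.
Qed.

Lemma demand_le x y : 0 <= x -> x <= y -> y <= h -> f y <= f x.
Proof.
by move=> x0; rewrite le_eqVlt => /orP[/eqP->//|xy] yh; exact/ltW/demand_lt.
Qed.

Lemma demand_gt0 x : 0 <= x -> x <= h -> 0 < f x.
Proof. by move=> x0 xh; have /andP[] : 0 < f x <= 1 by rewrite f_bounds// in_itv/= x0. Qed.

Lemma demand_le1 x : 0 <= x -> x <= h -> f x <= 1.
Proof. by move=> x0 xh; have /andP[] : 0 < f x <= 1 by rewrite f_bounds// in_itv/= x0. Qed.

(** By concavity the drop over a window of length eta is smallest at 0, where it is 1 - f(eta): the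
    chord inequalities on [0, y + eta] at eta and at y add up to this. *)
Lemma demand_gap eta x y : 0 <= eta -> 0 <= y -> y + eta <= x -> x <= h ->
  f x <= f y - (1 - f eta).
Proof.
move=> e0 y0 yx xh; apply: le_trans (demand_le _ _ (addr_ge0 y0 e0) yx xh) _.
have yeh := le_trans yx xh; have etah : eta <= y + eta by rewrite lerDr.
have yeta : y <= y + eta by rewrite lerDl.
have := concave_le _ _ _ (lexx 0) e0 etah yeh.
have := concave_le _ _ _ (lexx 0) y0 yeta yeh.
rewrite f0; have [s0|s0] := leP (y + eta) 0.
  have -> : y = 0 by lra.
  have -> : eta = 0 by lra.
  by rewrite !addr0 f0; lra.
by move=> ? ?; rewrite -(ler_pM2r s0); lra.
Qed.

(** * Tangents, the Lipschitz constant and the threshold phi_b *)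

Notation df := (derive_within `[0, h]%classic f).

Lemma slope_near x (d : R) : 0 <= x <= h -> 0 < d ->
  exists2 r, 0 < r & forall y, 0 <= y <= h -> y != x -> `|y - x| < r ->
    `|df x - slope f x y| < d.
Proof.
move=> xh d0; have cv := f_diff x; rewrite in_itv/= xh in cv.
have /cvgrPdist_lt/(_ _ d0) := cv isT.
rewrite near_withinE near_withinE => /nbhs_ballP[r /= r0 hr].
exists r => // y yh yx yr; apply: hr => //.
by rewrite /ball/= distrC.
Qed.

(** If f(y) lay above the tangent, all slopes from x towards y would stay away from f'(x) by
    concavity, including those at arbitrarily small distance [m]. *)
Lemma tangent_le x y : 0 <= x <= h -> 0 <= y <= h ->
  f y <= f x + df x * (y - x).
Proof.
move=> xh yh; have [->|yx] := eqVneq y x; first by rewrite subrr mulr0 addr0.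
rewrite leNgt; apply/negP => lt.
have [x0 x1] := andP xh; have [y0 y1] := andP yh.
move: yx; rewrite neq_lt => /orP[yx|xy].
  have xy0 : 0 < x - y by rewrite subr_gt0.
  have d0 : 0 < df x - slope f x y.
    rewrite subr_gt0 /slope -mulrNN -invrN opprB ltr_pdivrMr//; lra.
  have [r r0 hr] := slope_near _ _ xh d0.
  pose m := Num.min (x - y) (r / 2); have m0 : 0 < m by rewrite lt_min xy0 divr_gt0.
  have mxy : m <= x - y by rewrite ge_min lexx.
  have mr : m < r by rewrite gt_min; apply/orP; right; lra.
  have : `|df x - slope f x (x - m)| < df x - slope f x y.
    apply: hr; [apply/andP; split; lra|lra|].
    by rewrite addrAC subrr sub0r normrN gtr0_norm.
  apply/negP; rewrite -leNgt (le_trans _ (ler_norm _))// lerD2l lerN2.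
  rewrite /slope.
  have -> : (f (x - m) - f x) / (x - m - x) = (f x - f (x - m)) / m.
    by rewrite addrAC subrr sub0r invrN mulrN -mulNr opprB.
  have -> : (f y - f x) / (y - x) = (f x - f y) / (x - y).
    by rewrite -mulrNN -invrN !opprB.
  rewrite ler_pdivrMr// mulrAC ler_pdivlMr//.
  have yxm : y <= x - m by lra.
  have xmx : x - m <= x by lra.
  have := concave_le _ _ _ y0 yxm xmx x1; lra.
have xy0 : 0 < y - x by rewrite subr_gt0.
have d0 : 0 < slope f x y - df x.
  rewrite subr_gt0 /slope ltr_pdivlMr//; lra.
have [r r0 hr] := slope_near _ _ xh d0.
pose m := Num.min (y - x) (r / 2); have m0 : 0 < m by rewrite lt_min xy0 divr_gt0.
have mxy : m <= y - x by rewrite ge_min lexx.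
have mr : m < r by rewrite gt_min; apply/orP; right; lra.
have : `|df x - slope f x (x + m)| < slope f x y - df x.
  apply: hr; [apply/andP; split; lra|lra|].
  by rewrite addrAC subrr add0r gtr0_norm.
apply/negP; rewrite -leNgt distrC (le_trans _ (ler_norm _))// lerD2r.
rewrite /slope.
have -> : (f (x + m) - f x) / (x + m - x) = (f (x + m) - f x) / m.
  by rewrite addrAC subrr add0r.
rewrite ler_pdivlMr// mulrAC ler_pdivrMr//.
have yxm : x <= x + m by lra.
have xmx : x + m <= y by lra.
have := concave_le _ _ _ x0 yxm xmx y1; lra.
Qed.

Lemma derive_ge x c : 0 < x -> x <= h ->
  (forall y, 0 <= y -> y < x -> f y <= f x + c * (y - x)) -> c <= df x.
Proof.
move=> x0 x1 hc; rewrite leNgt; apply/negP => lt.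
have xh : 0 <= x <= h by rewrite ltW.
have d0 : 0 < c - df x by rewrite subr_gt0.
have [r r0 hr] := slope_near _ _ xh d0.
pose m := Num.min x (r / 2); have m0 : 0 < m by rewrite lt_min x0 divr_gt0.
have mxy : m <= x by rewrite ge_min lexx.
have mr : m < r by rewrite gt_min; apply/orP; right; lra.
have : `|df x - slope f x (x - m)| < c - df x.
  apply: hr; [apply/andP; split; lra|lra|].
  by rewrite addrAC subrr sub0r normrN gtr0_norm.
apply/negP; rewrite -leNgt distrC (le_trans _ (ler_norm _))// lerD2r.
rewrite /slope.
have -> : (f (x - m) - f x) / (x - m - x) = (f x - f (x - m)) / m.
  by rewrite addrAC subrr sub0r invrN mulrN -mulNr opprB.
rewrite ler_pdivlMr//.
have xm0 : 0 <= x - m by lra.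
have xmx : x - m < x by lra.
have := hc _ xm0 xmx; lra.
Qed.

(** The decline is steepest at the right end, so -f'(h) serves: the tangent at h bounds chords
    ending at h, and a chord over [x, y] is no steeper than the one over [y, h]. *)
Lemma demand_lipschitz :
  exists2 K, 0 <= K & forall x y, 0 <= x -> x <= y -> y <= h ->
    f x - f y <= K * (y - x).
Proof.
have hh : 0 <= h <= h by rewrite ltW/=.
have tan x : 0 <= x -> x <= h -> f x - f h <= - df h * (h - x).
  by move=> x0 xh; have := tangent_le _ x hh; rewrite x0 xh => /(_ isT); lra.
have K0 : 0 <= - df h.
  rewrite -(ler_pM2r h_gt0) mul0r; have := tan _ (lexx 0) (ltW h_gt0).
  by have := demand_le _ _ (lexx 0) (ltW h_gt0) (lexx h); lra.
exists (- df h) => // x y x0 xy; rewrite le_eqVlt => /orP[/eqP yh|yh].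
  by rewrite yh in xy *; exact: tan.
have hy : 0 < h - y by rewrite subr_gt0.
have y0 := le_trans x0 xy.
rewrite -(ler_pM2r hy); have := concave_le _ _ _ x0 xy (ltW yh) (lexx h).
have yx0 : 0 <= y - x by rewrite subr_ge0.
have := ler_wpM2r yx0 (tan _ y0 (ltW yh)); lra.
Qed.

(* f + 2 x f' >= 0 at x, stated without f': to the left of x, f lies below the
   line of slope - f(x) / (2 x) through (x, f(x)). This form passes to limits. *)
Definition steep_set : set R := [set x | 0 <= x <= h /\
  forall y, 0 <= y <= x -> 2 * x * f y <= f x * (3 * x - y)].

Lemma steep_setP : [set x | x \in `[0, h] /\ 0 <= f x + 2 * x * df x] = steep_set.
Proof.
apply/seteqP; split => x; rewrite /= in_itv/=.
  move=> [xh dx]; split => // y /andP[y0 yx]; have /andP[x0 x1] := xh.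
  have yh : 0 <= y <= h by rewrite y0 (le_trans yx).
  have x20 : 0 <= 2 * x by lra.
  have := ler_wpM2l x20 (tangent_le _ _ xh yh).
  have xy0 : 0 <= x - y by rewrite subr_ge0.
  have := mulr_ge0 dx xy0; lra.
move=> [xh sx]; split => //; have /andP[] := xh.
rewrite le_eqVlt => /orP[/eqP<- _|x0 x1]; first by rewrite mulr0 mul0r addr0 f0.
have x20 : 0 < 2 * x by lra.
suff : - (f x / (2 * x)) <= df x.
  rewrite lerNl ler_pdivlMr//; lra.
apply: derive_ge => // y y0 yx; have := sx y; rewrite y0 ltW// => /(_ isT) sxy.
rewrite -(ler_pM2l x20).
have -> : 2 * x * (f x + - (f x / (2 * x)) * (y - x)) = f x * (3 * x - y).
  by field; rewrite gt_eqF.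
by [].
Qed.

(** Outside the set f + 2 x f' < 0, and the tangent at x puts f below the same line, now to the
    right of x. *)
Lemma steep_setN x y : 0 <= x -> x <= y -> y <= h -> ~ steep_set x ->
  2 * x * f y <= f x * (3 * x - y).
Proof.
rewrite -steep_setP => x0 xy yh /=; rewrite in_itv/= x0 (le_trans xy yh) => nx.
have dx : f x + 2 * x * df x <= 0.
  by rewrite leNgt; apply/negP => /ltW ?; apply: nx.
have xh : 0 <= x <= h by rewrite x0 (le_trans xy).
have yh' : 0 <= y <= h by rewrite yh (le_trans x0).
have x20 : 0 <= 2 * x by lra.
have := ler_wpM2l x20 (tangent_le _ _ xh yh').
have xy0 : 0 <= y - x by rewrite subr_ge0.
have dx' : 0 <= - (f x + 2 * x * df x) by lra.
have := mulr_ge0 dx' xy0; lra.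
Qed.

(** The set contains 0 and is bounded by h; it contains its supremum because f is Lipschitz. *)
Lemma phi_b_max : steep_set (phi_b h f) /\ ubound steep_set (phi_b h f).
Proof.
rewrite /phi_b steep_setP /max_of.
suff [s ss] : exists s, steep_set s /\ ubound steep_set s.
  exact: (@xgetI _ 0 [set x | steep_set x /\ ubound steep_set x] s).
have S0 : steep_set 0.
  split=> [|y]; first by rewrite lexx ltW.
  by move=> /le_anti <-; rewrite !mulr0 mul0r subrr mulr0.
have ubS : ubound steep_set h by move=> x [/andP[]].
have hS : has_sup steep_set by split; [exists 0|exists h].
pose s := sup steep_set.
have us : ubound steep_set s by exact/ubP/sup_upper_bound.
have s0 : 0 <= s by exact: us.
have sh : s <= h by apply: ge_sup => //; exists 0.
exists s; split=> //; split; first by rewrite s0.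
move=> y /andP[y0]; rewrite le_eqVlt => /orP[/eqP->|ys]; first by lra.
have [K K0 lip] := demand_lipschitz.
rewrite leNgt; apply/negP => lt.
(* The defect c at s would have to arise between s and a point x of the set, but over that distance
   it grows by at most (2 + 3 K h)(s - x), and s - x < m <= c / B. *)
pose c := 2 * s * f y - f s * (3 * s - y).
have c0 : 0 < c by rewrite subr_gt0.
pose B := 3 + 3 * K * h.
have B0 : 0 < B by rewrite ltr_wpDr// !mulr_ge0// ltW.
pose m := Num.min (s - y) (c / B).
have m0 : 0 < m by rewrite lt_min subr_gt0 ys divr_gt0.
have [x [xh sx] mx] := sup_adherent m0 hS.
have mxy : m <= s - y by rewrite ge_min lexx.
have mc : m * B <= c by rewrite -ler_pdivlMr// ge_min lexx orbT.
have xs : x <= s by apply: us; split.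
have {}mx : s - m < x by exact: mx.
have /andP[x0 x1] := xh.
have yx : y < x by lra.
have := sx y; rewrite y0 (ltW yx) => /(_ isT) {}sx.
have fxs := lip _ _ x0 xs sh.
have fy1 := demand_le1 _ y0 (le_trans (ltW ys) sh).
have fs0 := demand_gt0 _ s0 sh.
have xy3 : 0 <= 3 * x - y by lra.
have h1 : 0 <= (f s + K * (s - x) - f x) * (3 * x - y).
  by rewrite mulr_ge0//; lra.
have h2 : 0 <= (s - x) * (1 - f y) by rewrite mulr_ge0//; lra.
have h3 : 0 <= (s - x) * f s by rewrite mulr_ge0//; lra.
have h4 : 0 <= K * (s - x) * (3 * h - (3 * x - y)).
  by rewrite !mulr_ge0//; lra.
have h5 : 0 <= (m - (s - x)) * B by rewrite mulr_ge0//; lra.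
have h6 : c <= (s - x) * (2 + 3 * K * h) by rewrite /c; lra.
have h7 : 0 < m - (s - x) by lra.
have := mulr_gt0 h7 B0.
rewrite /B in mc *.
have [sx0|sx0] := leP (s - x) 0; last by rewrite /B in h5; lra.
have : s = x by lra.
by move=> E; move: sx lt; rewrite -E; lra.
Qed.

(** * The high-price gain G and its maximizer *)

Variables (Lam e : R).
Hypotheses (Lam_gt0 : 0 < Lam) (e_gt0 : 0 < e) (rho_lt1 : rho Lam e < 1).

Local Notation r := (rho Lam e).
Local Notation G := (high_price_gain f Lam e).
Local Notation b := (phi_b h f).
Local Notation L := (phi_L h f Lam e).
Local Notation Rr := (phi_R h f Lam e).

Lemma rho_gt0 : 0 < r. Proof. exact: divr_gt0. Qed.
Let r0 := rho_gt0.

Lemma mul_rho : Lam * r = e.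
Proof. by rewrite /rho mulrC divfK// gt_eqF. Qed.

Lemma gainE x : r * G x = (f x - r) * x.
Proof. by rewrite /high_price_gain mulrC divfK// gt_eqF. Qed.

(** The concavity defect of (f - rho) x is y times that of f plus (f x - f z)(z - y)(y - x),
    positive since f decreases. *)
Lemma gain_concave_lt x y z : 0 <= x -> x < y -> y < z -> z <= h ->
  G x * (z - y) + G z * (y - x) < G y * (z - x).
Proof.
move=> x0 xy yz zh; have := concave_lt _ _ _ x0 xy yz zh => fc.
have rr := r0; rewrite -(ltr_pM2l r0).
rewrite (_ : r * _ = r * G x * (z - y) + r * G z * (y - x)); last by ring.
rewrite (_ : r * (G y * _) = r * G y * (z - x)); last by ring.
rewrite !gainE.
have y0 : 0 < y by exact: le_lt_trans xy.
have h1 : 0 < (f y * (z - x) - (f x * (z - y) + f z * (y - x))) * y.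
  by rewrite mulr_gt0// subr_gt0.
have h2 : 0 < (f x - f z) * ((z - y) * (y - x)).
  rewrite !mulr_gt0 ?subr_gt0//; apply: demand_lt => //; exact: lt_trans yz.
lra.
Qed.

Lemma phi_RP : Rr \in `[0, h] /\ forall x, x \in `[0, h] -> G x <= G Rr.
Proof.
rewrite /phi_R /argmax_on.
suff [x xh xm] : exists2 x, x \in `[0, h] & forall y, y \in `[0, h] -> G y <= G x.
  have := @xgetI _ 0 [set x | `[0, h]%classic x /\
    forall y, `[0, h]%classic y -> G y <= G x] x (conj xh xm).
  by [].
have [K K0 lip] := demand_lipschitz; have rr := r0.
apply: EVT_max; first exact: ltW.
apply: (@lipschitz_within_continuous _ _ _ ((1 + K * h + r) / r)) => x y /=.
rewrite !in_itv/= => /andP[x0 x1] /andP[y0 y1] xy.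
have -> : G y - G x = (r * G y - r * G x) / r by field; rewrite gt_eqF.
rewrite normrM normfV (gtr0_norm r0) ler_pdivrMr// [leRHS]mulrAC divfK ?gt_eqF//.
rewrite !gainE; have := lip _ _ x0 xy y1; have := demand_le _ _ x0 xy y1.
have fy0 := demand_gt0 _ y0 y1; have fy1 := demand_le1 _ y0 y1.
move=> fxy fk.
have xy0 : 0 <= y - x by rewrite subr_ge0.
have h1 : 0 <= (f x - f y) * x by rewrite mulr_ge0// subr_ge0.
have h2 : 0 <= (K * (y - x) - (f x - f y)) * x by rewrite mulr_ge0// subr_ge0.
have h3 : 0 <= K * (y - x) * (h - x) by rewrite !mulr_ge0// subr_ge0.
have h4 : 0 <= (1 - f y) * (y - x) by rewrite mulr_ge0// subr_ge0.
have h5 : 0 <= f y * (y - x) by rewrite mulr_ge0// ltW.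
have h6 : 0 <= r * (y - x) by rewrite mulr_ge0// ltW.
by rewrite ler_norml; apply/andP; split; lra.
Qed.

Lemma phi_LE : L = G Rr.
Proof.
have [Rh Rm] := phi_RP; rewrite /phi_L /max_of; apply: xget_unique.
  by split; [exists Rr|move=> _ [x xh <-]; exact: Rm].
by move=> _ [[x xh <-] xm]; apply/eqP; rewrite eq_le Rm//= xm//; exists Rr.
Qed.

Lemma gain_le_phi_L x : 0 <= x -> x <= h -> G x <= L.
Proof. by move=> x0 xh; rewrite phi_LE; apply: phi_RP.2; rewrite in_itv/= x0. Qed.

Lemma phi_R_ge0 : 0 <= Rr.
Proof. by have [] := phi_RP; rewrite in_itv/= => /andP[]. Qed.

Lemma phi_R_le : Rr <= h.
Proof. by have [] := phi_RP; rewrite in_itv/= => /andP[]. Qed.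

Lemma phi_L_gt0 : 0 < L.
Proof.
have [K K0 lip] := demand_lipschitz; have rr := r0; have r1 := rho_lt1.
(* A price so small that f x >= 1 - K x > rho, hence with positive gain. *)
pose x := Num.min h ((1 - r) / (K + 1)).
have K1 : 0 < K + 1 by lra.
have x0 : 0 < x by rewrite lt_min h_gt0 divr_gt0// subr_gt0.
have xh : x <= h by rewrite ge_min lexx.
have xK : x * (K + 1) <= 1 - r by rewrite -ler_pdivlMr// ge_min lexx orbT.
apply: lt_le_trans (gain_le_phi_L _ (ltW x0) xh).
rewrite -(ltr_pM2l r0) mulr0 gainE mulr_gt0//.
by have := lip _ _ (lexx 0) (ltW x0) xh; rewrite f0; lra.
Qed.

Lemma phi_R_gt0 : 0 < Rr.
Proof.
rewrite lt_neqAle phi_R_ge0 andbT; apply/eqP => E.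
by have := phi_L_gt0; rewrite phi_LE -E /high_price_gain mulr0 mul0r ltxx.
Qed.

Lemma rho_lt_demand_phi_R : r < f Rr.
Proof.
have := phi_L_gt0; rewrite phi_LE -(ltr_pM2l r0) mulr0 gainE.
by rewrite pmulr_lgt0 ?phi_R_gt0// subr_gt0.
Qed.

Lemma gain_mono x y : 0 <= x -> x <= y -> y <= Rr -> G x <= G y.
Proof.
move=> x0; rewrite le_eqVlt => /orP[/eqP->//|xy].
rewrite le_eqVlt => /orP[/eqP yR|yR].
  by rewrite yR in xy *; rewrite -phi_LE gain_le_phi_L// (ltW (lt_le_trans xy phi_R_le)).
have := gain_concave_lt _ _ _ x0 xy yR phi_R_le.
have xR : x <= Rr by lra.
have := gain_le_phi_L _ x0 (le_trans xR phi_R_le); rewrite phi_LE => GxR.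
have h1 : 0 <= (G Rr - G x) * (y - x) by rewrite mulr_ge0 ?subr_ge0// ltW.
have h2 : 0 < Rr - x by lra.
move=> h3; rewrite -(ler_pM2r h2); lra.
Qed.

(** If 2 rho < f h, then x0 = h and no price lies above. Otherwise, for y > x0, the tangent bounds
    give x0 f(y) <= rho (3 x0 - y), which multiplied by y reads x0 G(y) <= x0^2 - (y - x0)^2. *)
Lemma ext_inv_two_rho : 2 * r <= f b ->
  let x0 := ext_inv h f (2 * r) in
  [/\ 0 <= x0 <= h, 2 * r <= f x0 &
      forall x, x0 < x -> x <= h -> f x0 = 2 * r /\ G x <= x0].
Proof.
have rr := r0; have [[/andP[b0 bh] sb] ub] := phi_b_max.
move=> rb; rewrite /ext_inv.
have [lt|ge] := ltP (2 * r) (f h).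
  split; [by rewrite lexx ltW|exact: ltW|].
  by move=> x /lt_le_trans h1 /h1; rewrite ltxx.
rewrite (le_trans rb (demand_le1 _ b0 bh)).
have [K K0 lip] := demand_lipschitz.
have cf : {within `[0, h], continuous f}.
  apply: (@lipschitz_within_continuous _ _ _ K) => x y /=.
  rewrite !in_itv/= => /andP[x0 x1] /andP[y0 y1] xy.
  rewrite distrC ger0_norm; first by apply: lip => //; lra.
  by rewrite subr_ge0; apply: demand_le => //; lra.
have [|x xh fx] := @IVT _ f 0 h (2 * r) (ltW h_gt0) cf.
  by rewrite ge_min le_max ge f0 (le_trans rb (demand_le1 _ b0 bh)) orbT.
have /= [] := @xgetI _ 0 [set x | x \in `[0, h] /\ f x = 2 * r] x (conj xh fx).
move: (xget _ _) => {xh fx}x; rewrite in_itv/= => /andP[x0 xh] fx.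
split; [by rewrite x0|by rewrite fx|move=> y xy yh; split=> //].
have bx : b <= x.
  rewrite leNgt; apply/negP => xb.
  by have := demand_lt _ _ x0 xb bh; rewrite fx; lra.
(* Every z > x >= phi_b lies outside [steep_set], but x may equal phi_b; hence the passage to the
   limit z -> x in [lim]. *)
have lin z : x < z -> z < y -> z * f y <= r * (3 * z - y).
  move=> xz zy; have nz : ~ steep_set z.
    by move=> /ub; rewrite leNgt (le_lt_trans bx xz).
  have z0 : 0 < z by exact: le_lt_trans xz.
  have zh : z <= h by rewrite (le_trans (ltW zy)).
  have := steep_setN _ _ (ltW z0) (ltW zy) yh nz.
  have fy0 : 0 < f y by rewrite demand_gt0// (le_trans x0)// ltW.
  have := mulr_gt0 z0 fy0 => zfy szy.
  have fz0 := demand_gt0 _ (ltW z0) zh.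
  have p0 : 0 < 3 * z - y by rewrite -(pmulr_rgt0 _ fz0); lra.
  have := demand_le _ _ x0 (ltW xz) zh; rewrite fx -(ler_pM2r p0); lra.
have lim : x * f y <= r * (3 * x - y).
  rewrite leNgt; apply/negP => lt.
  pose c := x * f y - r * (3 * x - y).
  have c0 : 0 < c by rewrite subr_gt0.
  pose m := Num.min ((y - x) / 2) (c / (3 * r + 1)).
  have m0 : 0 < m by rewrite lt_min !divr_gt0//; lra.
  have mxy : m <= (y - x) / 2 by rewrite ge_min lexx.
  have mc : m * (3 * r + 1) <= c by rewrite -ler_pdivlMr ?ge_min ?lexx ?orbT//; lra.
  have xm : x < x + m by lra.
  have my : x + m < y by lra.
  have := lin _ xm my.
  have fy0 : 0 < f y by rewrite demand_gt0//; lra.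
  have := mulr_gt0 m0 fy0; rewrite /c in mc; lra.
have fy0 : 0 < f y by rewrite demand_gt0//; lra.
have x0' : 0 < x.
  rewrite lt_neqAle x0 andbT; apply/eqP => E.
  move: lim; rewrite -E mul0r mulr0 sub0r mulrN oppr_ge0 leNgt mulr_gt0//; lra.
rewrite -(ler_pM2l r0) gainE -(ler_pM2l x0').
have h1 : 0 <= (r * (3 * x - y) - x * f y) * y by rewrite mulr_ge0; lra.
have yx : 0 <= y - x by lra.
have h2 := mulr_ge0 (ltW r0) (mulr_ge0 yx yx).
lra.
Qed.

Lemma gain_lip x y : 0 <= x -> x <= y -> y <= h -> G y - G x <= (y - x) / r.
Proof.
move=> x0 xy yh; have rr := rho_gt0.
rewrite ler_pdivlMr// mulrC mulrBr !gainE.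
have h1 : 0 <= (f x - f y) * y.
  by rewrite mulr_ge0 ?subr_ge0 ?demand_le// (le_trans x0).
have h2 : 0 <= (1 - f x) * (y - x).
  by rewrite mulr_ge0 ?subr_ge0 ?demand_le1// (le_trans xy).
have h3 : 0 <= r * (y - x) by rewrite mulr_ge0 ?subr_ge0// ltW.
lra.
Qed.

(** Turns a price gap into the demand ratio that the payoff bounds ask for, uniformly in the prices:
    f drops by at least 1 - f(m), while theta f(y) <= theta for theta >= 0. *)
Lemma demand_gap_ratio eta : 0 < eta -> exists2 theta0, 0 < theta0 < 1 &
  forall theta x y, theta <= theta0 -> 0 <= y -> y + eta <= x -> x <= h ->
    f x < (1 - theta) * f y.
Proof.
move=> e0; pose m := Num.min eta h.
have m0 : 0 < m by rewrite lt_min e0.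
have mh : m <= h by rewrite ge_min lexx orbT.
have me : m <= eta by rewrite ge_min lexx.
have fm0 := demand_gt0 _ (ltW m0) mh.
have fm1 : f m < 1 by rewrite -f0 demand_lt.
exists ((1 - f m) / 2); first by apply/andP; split; lra.
move=> theta x y th y0 yx xh.
have yh : y <= h by lra.
have ymx : y + m <= x by lra.
have := demand_gap _ _ _ (ltW m0) y0 ymx xh.
have fy1 := demand_le1 _ y0 yh; have fy0 := demand_gt0 _ y0 yh.
have [th0|th0] := leP 0 theta.
  have : 0 <= theta * (1 - f y) by rewrite mulr_ge0// subr_ge0.
  lra.
have : 0 < (- theta) * f y by rewrite mulr_gt0// oppr_gt0.
lra.
Qed.

(** Since Lam rho = e, (Lam f(x) - e) x = e G(x); the bound [c] also covers the value 0 of the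
    maximum. *)
Lemma payoff_overpriced_gain theta M i x y c : near_limit h f Lam e theta M ->
  0 <= theta -> 0 <= x <= h -> 0 <= y <= h -> f x < (1 - theta) * f y ->
  0 <= c -> G x <= c -> M i (profile i x y) <= e * c + theta * e * h.
Proof.
move=> nM th0 xh yh gap c0 Gc.
apply: le_trans (payoff_overpriced _ _ _ _ _ _ nM i x y _ _ gap) _;
  rewrite ?in_itv//=.
have e0 := e_gt0; have L0 := Lam_gt0; have /andP[x0 x1] := xh.
have h1 := mulr_ge0 (mulr_ge0 th0 (ltW e0)) x0.
have h2 : 0 <= theta * e * (h - x) by rewrite mulr_ge0 ?mulr_ge0 ?subr_ge0// ltW.
have h3 := mulr_ge0 (ltW e0) c0.
have [_|_] := leP 0 (Lam * f x - (1 - theta) * e); last by rewrite mul0r; lra.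
have h4 : 0 <= e * (c - G x) by rewrite mulr_ge0 ?subr_ge0// ltW.
have h5 : e * G x = (Lam * f x - e) * x.
  have -> : e * G x = Lam * (r * G x) by rewrite mulrA mul_rho.
  by rewrite gainE mulrA mulrBr mul_rho.
have : e * (c - G x) = e * c - (Lam * f x - e) * x by rewrite mulrBr h5.
lra.
Qed.

Lemma pure_near_nash eps : 0 < eps -> r <= f b / 2 ->
  exists2 theta, 0 < theta < 1 & forall M, near_limit h f Lam e theta M ->
    pure_eps_nash h M eps (ext_inv h f (2 * r), ext_inv h f (2 * r)).
Proof.
move=> eps0 rb; have e0 := e_gt0; have h0 := h_gt0.
have rb2 : 2 * r <= f b by lra.
have [] := ext_inv_two_rho rb2.
move: (ext_inv _ _ _) => x0 x0h fx0 above.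
(* A deviation up to x0 + eta gains at most e eta = eps / 2 by the capacity bound, apart from the
   loss in theta; a higher one is overpriced and [above] applies. *)
pose eta := eps / (2 * e).
have eta0 : 0 < eta by rewrite divr_gt0// mulr_gt0.
have [th0 /andP[th00 th01] gap] := demand_gap_ratio _ eta0.
pose theta := Num.min th0 (eps / (8 * (e * h))).
have eh0 := mulr_gt0 e0 h0.
have th_gt0 : 0 < theta by rewrite lt_min th00 divr_gt0// mulr_gt0.
have th_le : theta <= th0 by rewrite ge_min lexx.
have th_eps : theta * (8 * (e * h)) <= eps.
  by rewrite -ler_pdivlMr ?mulr_gt0// ge_min lexx orbT.
exists theta; first by rewrite th_gt0 (le_lt_trans th_le).
move=> M nM; split; first by case.
move=> i x xh.
have -> : Defs.coord (other i) (x0, x0) = x0 by case: i.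
have -> : (x0, x0) = profile i x0 x0 by case: i.
have x0in : x0 \in `[0, h] by rewrite in_itv.
have rich : 2 * e <= Lam * f x0.
  have : Lam * (2 * r) <= Lam * f x0 by rewrite ler_pM2l.
  by have := mul_rho; lra.
have lo := payoff_floor_rich _ _ _ _ _ _ nM i _ _ x0in x0in rich.
apply: (@le_trans _ _ ((1 - 2 * theta) * e * x0 + eps)); last by rewrite lerD2r.
have /andP[x00 x0h'] := x0h; move: (xh); rewrite in_itv/= => /andP[xx0 xxh].
have p1 : 0 <= theta * e * (h - x0).
  by rewrite mulr_ge0 ?subr_ge0// mulr_ge0// ltW.
have [xnear|xfar] := leP x (x0 + eta).
  apply: le_trans (payoff_cap _ _ _ _ _ _ nM i _ _ xh x0in) _.
  have : e * x <= e * (x0 + eta) by rewrite ler_pM2l.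
  have : e * eta = eps / 2 by rewrite /eta; field; rewrite gt_eqF.
  lra.
have xgt : x0 < x by lra.
have [fx0E Gx] := above _ xgt xxh.
have gx := gap _ _ _ th_le x00 (ltW xfar) xxh.
have xh' : 0 <= x <= h by rewrite xx0.
have := payoff_overpriced_gain _ _ i _ _ _ nM (ltW th_gt0) xh' x0h gx x00 Gx.
lra.
Qed.

(** * The regime f(phi_b) / 2 < rho: the equilibrium cycle *)

Section BelowTwoRho.
Hypothesis b_rho : f b / 2 < r.

(** Otherwise phi_R < phi_b, and the inequality of [steep_set] at phi_b combined with G(phi_b) <=
    G(phi_R) leaves rho (phi_b - phi_R)^2 <= 0. *)
Lemma demand_phi_R_lt : f Rr < 2 * r.
Proof.
have [[/andP[b0 bh] sb] _] := phi_b_max.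
rewrite ltNge; apply/negP => fR; have br := b_rho; have rr := r0.
have Rb : Rr < b.
  rewrite ltNge; apply/negP => bR.
  have := demand_le _ _ b0 bR phi_R_le; lra.
have R0 := phi_R_ge0.
have := sb Rr; rewrite R0 (ltW Rb) => /(_ isT) {}sb.
have := gain_le_phi_L _ b0 bh; rewrite phi_LE -(ler_pM2l r0) !gainE => Gb.
have h1 : 0 < 3 * b - Rr by lra.
have h2 : 0 <= (f Rr - 2 * r) * (b * (2 * b)  - Rr * (3 * b - Rr)).
  have -> : b * (2 * b)  - Rr * (3 * b - Rr) = (b - Rr) * (2 * b - Rr) by ring.
  by rewrite !mulr_ge0//; lra.
have h3 : 0 <= ((f Rr - r) * Rr - (f b - r) * b) * (3 * b - Rr).
  by rewrite mulr_ge0//; lra.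
have h4 : 0 <= (f b * (3 * b - Rr) - 2 * b * f Rr) * b by rewrite mulr_ge0//; lra.
have bR : 0 < b - Rr by lra.
have h5 := mulr_gt0 r0 (mulr_gt0 bR bR).
lra.
Qed.

Lemma phi_L_lt_phi_R : L < Rr.
Proof.
rewrite phi_LE -(ltr_pM2l r0) gainE ltr_pM2r ?phi_R_gt0//.
by have := demand_phi_R_lt; lra.
Qed.

(** Otherwise f takes the value 2 rho at some x in [phi_L, phi_R]. There G(x) = x, so x = phi_L and
    G would have two maximizers, against strict concavity at their midpoint. *)
Lemma demand_phi_L_lt : f L < 2 * r.
Proof.
have L0 := ltW phi_L_gt0; have LR := ltW phi_L_lt_phi_R; have Rh := phi_R_le.
have R0 := phi_R_gt0; have rr := r0.
rewrite ltNge; apply/negP => fL.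
have [K K0 lip] := demand_lipschitz.
have cf : {within `[L, Rr], continuous f}.
  apply: (@lipschitz_within_continuous _ _ _ K) => x y /=.
  rewrite !in_itv/= => /andP[x0 x1] /andP[y0 y1] xy.
  rewrite distrC ger0_norm; first by apply: lip => //; lra.
  by rewrite subr_ge0; apply: demand_le => //; lra.
have [|x] := @IVT _ f L Rr (2 * r) LR cf.
  by rewrite ge_min le_max fL (ltW demand_phi_R_lt) orbT.
rewrite in_itv/= => /andP[Lx xR] fx.
have Gx : G x = x.
  by apply: (mulfI (lt0r_neq0 r0)); rewrite gainE fx; ring.
have x0 : 0 <= x by lra.
have xL : x <= L by rewrite -{1}Gx gain_le_phi_L//; lra.
have {Lx xL} xL : x = L by apply/eqP; rewrite eq_le xL.
have {}LR := phi_L_lt_phi_R.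
pose m := (L + Rr) / 2.
have Lm : L < m by rewrite /m; lra.
have mR : m < Rr by rewrite /m; lra.
have := gain_concave_lt _ _ _ L0 Lm mR Rh.
have m0 : 0 <= m by lra.
have := gain_le_phi_L _ m0 (ltW (lt_le_trans mR Rh)).
rewrite -xL Gx -phi_LE -xL => Gm.
have h1 : 0 <= (x - G m) * (Rr - x) by rewrite mulr_ge0//; lra.
lra.
Qed.

Lemma capacity_demand x : 0 <= x -> x <= Rr -> e <= Lam * f x.
Proof.
move=> x0 xR; rewrite -{1}mul_rho ler_pM2l//.
apply: (@le_trans _ _ (f Rr)); last by rewrite demand_le// phi_R_le.
exact/ltW/rho_lt_demand_phi_R.
Qed.

Lemma cycle_near_limit eps : 0 < eps ->
  exists2 theta, 0 < theta < 1 & forall M, near_limit h f Lam e theta M ->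
    eps_equilibrium_cycle h M eps L Rr.
Proof.
move=> eps0; have e0 := e_gt0; have h0 := h_gt0; have L0 := phi_L_gt0.
have LR := phi_L_lt_phi_R; have Rh := phi_R_le; have rr := rho_gt0.
have fL := demand_phi_L_lt.
have Lh : L <= h by lra.
have fL0 := demand_gt0 _ (ltW L0) Lh.
(* The relative margin by which half the market at price phi_L falls short of capacity: Lam f(phi_L)
   / 2 = e (1 - k). *)
pose k := 1 - f L / (2 * r).
have k0 : 0 < k by rewrite subr_gt0 ltr_pdivrMr ?mul1r// mulr_gt0.
have k1 : k < 1 by rewrite /k gtrBl divr_gt0// mulr_gt0.
have kE : Lam * f L / 2 = e * (1 - k).
  rewrite (_ : e * (1 - k) = Lam * r * (f L / (2 * r))).
    by field; rewrite gt_eqF.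
  by rewrite mul_rho /k; ring.
have kL := mulr_gt0 k0 L0.
pose eta := Num.min (eps / 2) (k * L / 4).
have eta0 : 0 < eta by rewrite lt_min !divr_gt0.
have eta_eps : eta <= eps / 2 by rewrite ge_min lexx.
have eta_k : eta <= k * L / 4 by rewrite ge_min lexx orbT.
have [th0 /andP[th00 th01] gap] := demand_gap_ratio _ eta0.
pose theta := Num.min th0 (Num.min (eps / (8 * h)) (k * L / (4 * h))).
have th_gt0 : 0 < theta by rewrite !lt_min th00 !divr_gt0// mulr_gt0.
have th_le : theta <= th0 by rewrite ge_min lexx.
have th_eps : theta * (8 * h) <= eps.
  by rewrite -ler_pdivlMr ?mulr_gt0// !ge_min lexx orbT.
have th_k : theta * (4 * h) <= k * L.
  by rewrite -ler_pdivlMr ?mulr_gt0// !ge_min lexx !orbT.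
exists theta; first by rewrite th_gt0 (le_lt_trans th_le).
move=> M nM; clear fL fL0 rr kL th00 th01.
have slack y : y <= Rr - eps -> 0 <= theta * (h - (y - eta)).
  by move=> yR; rewrite mulr_ge0 ?(ltW th_gt0)//; clear th_eps th_k eta_k kE k0 k1 eta_eps; lra.
have RE y : (1 - theta) * e * (y - eta) = e * ((1 - theta) * (y - eta)) by ring.
have under i y : L + eps <= y -> y <= Rr - eps ->
    (1 - theta) * e * (y - eta) <= M i (profile i (y - eta) y).
  move=> Ly yR; apply: (payoff_undercut _ _ _ _ _ _ nM).
  - by rewrite in_itv/=; apply/andP; split; lra.
  - by rewrite in_itv/=; apply/andP; split; lra.
  - by apply: gap => //; lra.
  - by apply: capacity_demand; lra.
(* Such prices are overpriced and earn at most e (phi_L + theta h), while y - eta exceeds phi_L by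
   eps / 2 or more. *)
have far i x y : L + eps <= y -> y <= Rr - eps -> y + eta <= x -> x <= h ->
    M i (profile i x y) < M i (profile i (y - eta) y).
  move=> Ly yR yx xh; apply: lt_le_trans (under i y Ly yR).
  have y0 : 0 <= y by lra.
  have x0 : 0 <= x by lra.
  have gx := gap _ _ _ th_le y0 yx xh.
  have xh' : 0 <= x <= h by rewrite x0.
  have yh' : 0 <= y <= h by rewrite y0/=; lra.
  have := payoff_overpriced_gain _ _ i _ _ _ nM (ltW th_gt0) xh' yh' gx (ltW L0)
    (gain_le_phi_L _ x0 xh) .
  move=> /le_lt_trans; apply.
  rewrite RE (_ : _ + _ = e * (L + theta * h)) ?ltr_pM2l//; last by ring.
  have := slack y yR.
  lra.
(* Within eta of y the bound e (1 - k) x applies, and k phi_L outweighs both 2 eta and theta h. *)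
have above i x y : L + eps <= y -> y <= Rr - eps -> y <= x -> x <= h ->
    M i (profile i x y) < M i (profile i (y - eta) y).
  move=> Ly yR yx xh; have [/far|near] := leP (y + eta) x; first exact.
  apply: lt_le_trans (under i y Ly yR).
  have y0 : 0 <= y by lra.
  have x0 : 0 <= x by lra.
  have xin : x \in `[0, h] by rewrite in_itv/= x0.
  have yin : y \in `[0, h] by rewrite in_itv/= y0/=; lra.
  apply: le_lt_trans (payoff_higher _ _ _ _ _ _ nM i x y xin yin yx) _.
  have fxL : f x <= f L by apply: demand_le => //; [exact: ltW|lra].
  apply: (@le_lt_trans _ _ (e * (1 - k) * x)).
    rewrite -kE ler_wpM2r// ler_pM2r// ler_pM2l//.
  rewrite RE -mulrA ltr_pM2l//.
  have := slack y yR.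
  have : 0 <= (1 - k) * (y + eta - x) by rewrite mulr_ge0 ?subr_ge0// ltW.
  have : 0 <= k * (y - L).
    by rewrite mulr_ge0 ?(ltW k0)//; clear th_eps th_k eta_k kE k1 eta_eps near; lra.
  have := mulr_gt0 k0 eta0.
  lra.
have outside i z y : L + eps <= y -> y <= Rr - eps -> z \in `[0, h] ->
    z \notin `[L - eps, Rr + eps] ->
    M i (profile i z y) < M i (profile i (y - eta) y).
  move=> Ly yR zh; move: (zh); rewrite !in_itv/= => /andP[z0 z1].
  rewrite negb_and -!ltNge => /orP[zL|zR]; last by apply: far => //; lra.
  apply: lt_le_trans (under i y Ly yR).
  have yin : y \in `[0, h] by rewrite in_itv/=; apply/andP; split; lra.
  apply: le_lt_trans (payoff_cap _ _ _ _ _ _ nM i z y zh yin) _.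
  rewrite RE ltr_pM2l//.
  have := slack y yR.
  lra.
have inLR y : L + eps <= y -> y <= Rr - eps -> y - eta \in `[L, Rr].
  move=> Ly yR; rewrite in_itv/=; clear th_eps th_k eta_k kE k0 k1.
  by apply/andP; split; lra.
clear far under RE slack th_gt0 th_le th_eps th_k gap nM eta_k k0 k1 kE.
split.
- by apply/and3P; split; lra.
- move=> i y; rewrite in_itv/= => /andP[Ly yR].
  by exists (y - eta) => [|z zh zo]; [exact: inLR|exact: outside].
(* The player with the higher or equal price undercuts. *)
- move=> [x y] xy.
  have := xy P1; have := xy P2; rewrite !in_itv/= => /andP[Ly yR] /andP[Lx xR].
  have [yx|/ltW xy'] := leP y x.
    exists P1, (y - eta); split; [exact: inLR| |].
      by apply: (above P1) => //; lra.
    by move=> z zh zo; exact: (outside P1).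
  exists P2, (x - eta); split; [exact: inLR| |].
    by apply: (above P2) => //; lra.
  by move=> z zh zo; exact: (outside P2).
move=> [c [d [cd sub ci _]]].
have : c \in `[L + eps, Rr - eps] by apply: sub; rewrite in_itv/= lexx.
rewrite in_itv/= => /andP[Lc cR].
(* Condition (i) would give an answer x in [c, d] to c that beats c - eta, against [above]. *)
have [|x] := ci P1 c; first by rewrite addr0 subr0 in_itv/= lexx.
rewrite in_itv/= => /andP[cx xd] /(_ (c - eta)).
have dR : d <= Rr - eps.
  have : d \in `[L + eps, Rr - eps] by apply: sub; rewrite in_itv/= lexx andbT.
  by rewrite in_itv/= => /andP[].
rewrite !in_itv/= subr0 addr0 (_ : 0 <= c - eta <= h); last first.
  by apply/andP; split; lra.
rewrite (_ : ~~ _); last by rewrite negb_and -ltNge gtrBl eta0.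
move=> /(_ isT isT); apply/negP; rewrite -leNgt ltW//.
by apply: (above P1) => //; lra.
Qed.

(** * The distribution function of sigma^* and the mixed equilibrium *)

Definition clamp t : R := Num.max L (Num.min t Rr).

Lemma clamp_bounds t : L <= clamp t <= Rr.
Proof.
by rewrite /clamp le_max lexx/= ge_max ge_min lexx orbT (ltW phi_L_lt_phi_R).
Qed.

Lemma clamp_id t : L <= t -> t <= Rr -> clamp t = t.
Proof. by move=> Lt tR; rewrite /clamp min_l// max_r. Qed.

Lemma clamp_lo t : t <= L -> clamp t = L.
Proof. by move=> tL; rewrite /clamp max_l// ge_min tL. Qed.

Lemma clamp_hi t : Rr <= t -> clamp t = Rr.
Proof. by move=> Rt; rewrite /clamp min_r// max_r// ltW// phi_L_lt_phi_R. Qed.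

(** The projection onto [phi_L, phi_R] is 1-Lipschitz, so estimates for [star_cdf] on the support
    extend to the whole line. *)
Lemma clamp_lip t u : t <= u -> clamp t <= clamp u <= clamp t + (u - t).
Proof.
move=> tu; have LR := phi_L_lt_phi_R; rewrite /clamp.
case: (leP t Rr) => tR; case: (leP u Rr) => uR; case: (leP L t) => Lt;
  case: (leP L u) => Lu; rewrite ?(max_r (ltW LR)); apply/andP; split; lra.
Qed.

(** rho (u - G u) = (2 rho - f u) u, whose factors are nonnegative and nondecreasing on the support,
    so the minimum is at phi_L. This keeps the denominator of [star_cdf] away from 0. *)
Lemma gain_gap u : L <= u -> u <= Rr -> L * (2 * r - f L) / r <= u - G u.
Proof.
move=> Lu uR; have rr := rho_gt0; have L0 := phi_L_gt0; have Rh := phi_R_le.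
rewrite ler_pdivrMr// [leRHS]mulrBl [G u * r]mulrC gainE.
have fu : f u <= f L by apply: demand_le; lra.
have h1 : 0 <= (f L - f u) * L by rewrite mulr_ge0//; lra.
have h2 : 0 <= (2 * r - f u) * (u - L).
  by rewrite mulr_ge0//; have := demand_phi_L_lt; lra.
lra.
Qed.

Lemma gain_gap_gt0 : 0 < L * (2 * r - f L) / r.
Proof.
apply: divr_gt0 => //; apply: mulr_gt0; first exact: phi_L_gt0.
by rewrite subr_gt0 demand_phi_L_lt.
Qed.

(* The distribution function of sigma^*: numerator and denominator of the
   defining formula are e (t - phi_L) and e (t - G t). *)
Definition star_cdf t : R := (clamp t - L) / (clamp t - G (clamp t)).

Lemma star_cdfE t : L <= t -> t <= Rr -> star_cdf t * (t - G t) = t - L.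
Proof.
move=> Lt tR; rewrite /star_cdf clamp_id// divfK// gt_eqF//.
exact: lt_le_trans gain_gap_gt0 (gain_gap _ Lt tR).
Qed.

Lemma star_cdf_lo t : t <= L -> star_cdf t = 0.
Proof. by move=> tL; rewrite /star_cdf clamp_lo// subrr mul0r. Qed.

Lemma star_cdf_hi t : Rr <= t -> star_cdf t = 1.
Proof.
move=> Rt; rewrite /star_cdf clamp_hi// -phi_LE divff// gt_eqF// subr_gt0.
exact: phi_L_lt_phi_R.
Qed.

Lemma star_cdf_bounds t : 0 <= star_cdf t <= 1.
Proof.
have /andP[Lt tR] := clamp_bounds t; have g0 := gain_gap_gt0.
have gg := gain_gap _ Lt tR; have L0 := phi_L_gt0.
have Gc : G (clamp t) <= L.
  by apply: gain_le_phi_L; [lra|have := phi_R_le; lra].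
by rewrite /star_cdf divr_ge0 ?ler_pdivrMr ?mul1r/=; lra.
Qed.

(** Subtracting F(t) (t - G t) = t - phi_L at two clamped points gives [key]. As G is nondecreasing
    up to phi_R with slopes at most 1 / rho, it yields both monotonicity and the constant. *)
Lemma star_cdf_lip : exists2 K, 0 <= K & forall t u, t <= u ->
  0 <= star_cdf u - star_cdf t <= K * (u - t).
Proof.
have c0 := gain_gap_gt0; have rr := rho_gt0; have L0 := phi_L_gt0.
pose c := L * (2 * r - f L) / r.
have r10 : 0 < 1 + r^-1 by rewrite ltr_wpDr ?invr_ge0 ?ltW.
exists ((1 + r^-1) / c); first by rewrite divr_ge0// ltW.
move=> t u tu; have /andP[tu1 tu2] := clamp_lip _ _ tu.
have /andP[Lt tR] := clamp_bounds t; have /andP[Lu uR] := clamp_bounds u.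
have E s : star_cdf s = star_cdf (clamp s).
  by have /andP[? ?] := clamp_bounds s; rewrite /star_cdf (clamp_id (clamp s)).
have := star_cdfE _ Lt tR; have := star_cdfE _ Lu uR; rewrite -!E.
have := gain_gap _ Lu uR; rewrite -/c.
have /andP[F0 F1] := star_cdf_bounds t.
have t0 : 0 <= clamp t by lra.
have uh : clamp u <= h by have := phi_R_le; lra.
have := gain_lip _ _ t0 tu1 uh; have := gain_mono _ _ t0 tu1 uR.
move: (star_cdf t) (star_cdf u) F0 F1 => F F' F0 F1.
move: (G (clamp t)) (G (clamp u)) tu1 tu2 => g g'.
move: (clamp t) (clamp u) => x y xy yx gg lip cy Fy Fx.
rewrite mulrAC ler_pdivlMr//.
have y0 : 0 < y - g' by exact: lt_le_trans cy.
have key : (F' - F) * (y - g') = (y - x) * (1 - F) + F * (g' - g).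
  have -> : (F' - F) * (y - g') = F' * (y - g') - F * (x - g) - F * (y - g' - (x - g)) by ring.
  by rewrite Fy Fx; ring.
have k1 : 0 <= (y - x) * (1 - F) by rewrite mulr_ge0 ?subr_ge0.
have k2 : 0 <= F * (g' - g) by rewrite mulr_ge0 ?subr_ge0.
have d0 : 0 <= F' - F by rewrite -(pmulr_lge0 _ y0) key addr_ge0.
rewrite d0/=.
have k3 : 0 <= (F' - F) * (y - g' - c) by rewrite mulr_ge0// subr_ge0.
have k4 : 0 <= (y - x) * F by rewrite mulr_ge0 ?subr_ge0.
have k5 : 0 <= (1 - F) * (g' - g) by rewrite mulr_ge0 ?subr_ge0.
have k6 : 0 <= r^-1 * (u - t - (y - x)).
  by apply: mulr_ge0; [rewrite invr_ge0 ltW|lra].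
lra.
Qed.

Lemma star_measure : exists s : probability R R,
  forall t, s `]-oo, t]%classic = (star_cdf t)%:E.
Proof.
have [K K0 lip] := star_cdf_lip.
apply: probability_of_cdf.
- by move=> t u /lip /andP[]; rewrite subr_ge0.
- suff cF : continuous star_cdf by move=> t; exact/cvg_at_right_filter/cF.
  have : {within setT, continuous star_cdf}.
    apply: (@lipschitz_within_continuous _ _ _ K) => t u _ _ /lip /andP[? ?].
    by rewrite ger0_norm.
  move=> /subspace_continuousP + t => /(_ t I) ct A /ct.
  by rewrite /nbhs/= /within/=; apply: (@filterS _ (nbhs t) _) => u; exact.
- apply: cvg_near_cst; near=> t; apply: star_cdf_lo; near: t.
  by apply: nbhs_ninfty_le; rewrite num_real.
- apply: cvg_near_cst; near=> t; apply: star_cdf_hi; near: t.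
  by apply: nbhs_pinfty_ge; rewrite num_real.
Unshelve. all: by end_near. Qed.

Lemma star_measure_itv (s : probability R R) :
  (forall t, s `]-oo, t]%classic = (star_cdf t)%:E) ->
  forall t, L <= t -> s `[L, t]%classic = (star_cdf t)%:E.
Proof.
move=> sF t Lt; rewrite -sF.
have sL : s `]-oo, L[%classic = 0%E.
  apply/eqP; rewrite -measure_le0 -[leRHS]/(0%:E) -(star_cdf_lo L (lexx _)) -sF.
  by apply: le_measure; rewrite ?inE//; apply: subset_itvl; rewrite bnd_simp.
rewrite (_ : `]-oo, t]%classic = `]-oo, L[%classic `|` `[L, t]%classic).
  rewrite measureU//.
    have fin (X Y : \bar R) : X = 0%E -> (X + Y = Y)%E by move=> ->; rewrite add0e.
    by symmetry; exact: fin.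
  apply/seteqP; split => // x []; rewrite /= !in_itv/= => xL /andP[].
  by rewrite leNgt xL.
by rewrite (@itv_bndbnd_setU _ _ -oo%O (BLeft L))// bnd_simp.
Qed.

Lemma star_measure_is_sigma_star (s : probability R R) :
  (forall t, s `]-oo, t]%classic = (star_cdf t)%:E) ->
  is_sigma_star h f Lam e s.
Proof.
move=> sF; have LR := phi_L_lt_phi_R; split.
  by rewrite star_measure_itv ?star_cdf_hi// ltW.
move=> t; rewrite in_itv/= => /andP[Lt tR]; rewrite star_measure_itv//; congr (_%:E).
rewrite /star_cdf clamp_id// phi_LE /high_price_gain.
have /lt_le_trans/(_ (gain_gap _ Lt tR)) := gain_gap_gt0.
have e0 := e_gt0; have L0 := Lam_gt0; rewrite /high_price_gain /rho => den0.
have den : 2 * e * t - Lam * f t * t != 0.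
  rewrite gt_eqF//.
  have -> : 2 * e * t - Lam * f t * t = e * (t - (f t - e / Lam) * t / (e / Lam)).
    by field; rewrite !gt_eqF.
  exact: mulr_gt0.
by field; rewrite den !gt_eqF.
Qed.
(** Up to the factor e, the left side bounds the limit payoff of x against sigma^*, with every rival
    price above x - eta counted as undercut. At t = x - eta in the support, t (1 - F) + G(t) F =
    phi_L; replacing t by x costs at most eta + eta / rho. *)
Lemma star_cdf_upper eta x : 0 < eta -> 0 <= x -> x <= h ->
  x * (1 - star_cdf (x - eta)) + Num.max 0 (G x) * star_cdf (x - eta) <=
  L + eta + eta / r.
Proof.
move=> eta0 x0 xh; have rr := rho_gt0; have L0 := phi_L_gt0.
have Rh := phi_R_le.
have er : 0 <= eta / r by rewrite divr_ge0// ltW.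
have GL := gain_le_phi_L _ x0 xh.
have [tL|tL] := leP (x - eta) L; first by rewrite star_cdf_lo//; lra.
have [tR|tR] := leP Rr (x - eta).
  rewrite star_cdf_hi//; have : Num.max 0 (G x) <= L by rewrite ge_max GL ltW.
  lra.
have t0 : 0 <= x - eta by lra.
have tx : x - eta <= x by lra.
have := star_cdfE _ (ltW tL) (ltW tR); have := gain_lip _ _ t0 tx xh.
rewrite subKr => lip.
have Gt0 : 0 <= G (x - eta).
  by have := gain_mono _ _ (lexx 0) t0 (ltW tR); rewrite {1}/high_price_gain mulr0 mul0r.
have : Num.max 0 (G x) <= G (x - eta) + eta / r by rewrite ge_max; apply/andP; split; lra.
have /andP[F0 F1] := star_cdf_bounds (x - eta).
move: (star_cdf _) (Num.max _ _) (G (x - eta)) F0 F1 lip Gt0 => F m g F0 F1 lip g0 mg E.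
have h1 : 0 <= (g + eta / r - m) * F by rewrite mulr_ge0 ?subr_ge0.
have h2 : 0 <= eta / r * (1 - F) by rewrite mulr_ge0 ?subr_ge0.
have h3 : 0 <= eta * F by rewrite mulr_ge0// ltW.
lra.
Qed.

(** Only rival prices above x + eta count as undercut here, and the identity is used at t = x +
    eta. *)
Lemma star_cdf_lower eta x : 0 < eta -> L <= x -> x <= Rr ->
  L - eta - eta / r <=
  x * (1 - star_cdf (x + eta)) + G x * star_cdf (x + eta).
Proof.
move=> eta0 Lx xR; have rr := rho_gt0; have L0 := phi_L_gt0.
have Rh := phi_R_le.
have er : 0 <= eta / r by rewrite divr_ge0// ltW.
have x0 : 0 <= x by lra.
have [tR|tR] := leP Rr (x + eta).
  rewrite star_cdf_hi//; have := gain_lip _ _ x0 xR Rh; rewrite -phi_LE => lip.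
  have : (Rr - x) / r <= eta / r by rewrite ler_pM2r ?invr_gt0//; lra.
  lra.
have xt : x <= x + eta by lra.
have Lt : L <= x + eta by lra.
have := star_cdfE _ Lt (ltW tR); have := gain_lip _ _ x0 xt (le_trans (ltW tR) Rh).
rewrite [x + eta - x]addrAC subrr add0r.
have := gain_mono _ _ x0 xt (ltW tR).
have /andP[F0 F1] := star_cdf_bounds (x + eta).
move: (star_cdf _) (G (x + eta)) F0 F1 => F g F0 F1 gG lip E.
have h1 : 0 <= (1 - F) * (g - G x) by rewrite mulr_ge0 ?subr_ge0.
have h3 : 0 <= eta * F by rewrite mulr_ge0// ltW.
lra.
Qed.

Lemma mixed_near_nash eps : 0 < eps ->
  exists2 theta, 0 < theta < 1 & forall M, near_limit h f Lam e theta M ->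
    exists2 sigma : probability R R, is_sigma_star h f Lam e sigma &
      mixed_eps_nash h M eps (sigma, sigma).
Proof.
move=> eps0; have e0 := e_gt0; have h0 := h_gt0; have L0 := phi_L_gt0.
have Lam0 := Lam_gt0.
have LR := phi_L_lt_phi_R; have Rh := phi_R_le; have rr := rho_gt0.
have [s sF] := star_measure.
have star := star_measure_is_sigma_star _ sF.
(* Chosen so that shifting by eta costs e (eta + eta / rho) = eps / 4 in each of the two bounds. *)
pose w := e * (1 + r^-1).
have w0 : 0 < w by rewrite mulr_gt0// ltr_wpDr// invr_ge0 ltW.
pose eta := eps / (4 * w).
have eta0 : 0 < eta by rewrite divr_gt0// mulr_gt0.
have etaw : w * eta = eps / 4 by rewrite /eta; field; rewrite gt_eqF.
have etaE : e * (eta + eta / r) = eps / 4 by rewrite -etaw /w; ring.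
have [th0 /andP[th00 th01] gap] := demand_gap_ratio _ eta0.
(* [B] collects the losses in theta: [theta * e * h] for the deviation, [theta * (e + Lam) * h] for
   the mixed payoff. *)
pose B := (2 * e + Lam) * h.
have B0 : 0 < B by rewrite mulr_gt0// addr_gt0// mulr_gt0.
pose theta := Num.min th0 (eps / (2 * B)).
have th_gt0 : 0 < theta by rewrite lt_min th00 divr_gt0// mulr_gt0.
have th_le : theta <= th0 by rewrite ge_min lexx.
have B20 : 0 < 2 * B by exact: mulr_gt0.
have th_eps : theta * (2 * B) <= eps.
  by rewrite -ler_pdivlMr// ge_min lexx orbT.
have teh0 : 0 <= theta * e * h by rewrite !mulr_ge0// ltW.
have tLh0 : 0 <= theta * Lam * h by rewrite !mulr_ge0// ltW.
exists theta; first by rewrite th_gt0 (le_lt_trans th_le).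
move=> M nM; exists s => //; clear th00 B20 w0 etaw.
have LRD : `[L, Rr] `<=` `[0, h]%classic.
  by move=> x; rewrite /= !in_itv/= => /andP[Lx xR]; apply/andP; split; lra.
split.
  have sD : s `[0, h]%classic = 1%E.
    apply/eqP; rewrite eq_le probability_le1//=.
    by rewrite -star.1 le_measure// inE.
  by case.
move=> i x xh; move: (xh); rewrite in_itv/= => /andP[x0 xh'].
have Dev : (deviation_payoff h M i x s <= (e * L + eps / 4 + theta * e * h)%:E)%E.
  apply: (@le_trans _ _ ((e * Num.max 0 (G x) + theta * e * h) * star_cdf (x - eta)
      + e * x * (1 - star_cdf (x - eta)))%:E).
    apply: (integral_step_le s _ _ (x - eta)) => //.
    - by rewrite addr_ge0// mulr_ge0 ?(ltW e0)// le_max lexx.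
    - by rewrite mulr_ge0// ltW.
    - by move=> y yh; exact: (payoff_ge0 _ _ _ _ _ _ nM).
    - move=> y; rewrite /= in_itv/= => /andP[y0 yh] yx.
      apply: (payoff_overpriced_gain _ _ _ _ _ _ nM (ltW th_gt0)).
      + by rewrite x0.
      + by rewrite y0.
      + by apply: gap => //; lra.
      + by rewrite le_max lexx.
      + by rewrite le_max lexx orbT.
    - by move=> y yh; exact: (payoff_cap _ _ _ _ _ _ nM).
  rewrite lee_fin; have /andP[F0 F1] := star_cdf_bounds (x - eta).
  have up := ler_wpM2l (ltW e0) (star_cdf_upper _ _ eta0 x0 xh').
  have : 0 <= theta * e * h * (1 - star_cdf (x - eta)) by rewrite mulr_ge0 ?subr_ge0.
  lra.
have Mix : ((e * L - eps / 4 - theta * (e + Lam) * h)%:E <= mixed_payoff h M i (s, s))%E.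
  have th1 : 0 < 1 - theta by lra.
  clear Dev xh x0 xh' x th_eps B0.
  (* [lo] is a floor against any rival price, [hi] the payoff when undercutting; [clamp] makes both
     monotone on the whole line. *)
  pose lo z := Num.max 0 (e * G (clamp z) - theta * Lam * h).
  pose hi z := (1 - theta) * e * clamp z.
  have cmono : {homo clamp : z z' / z <= z'} by move=> z z' /clamp_lip/andP[].
  have c0 z : 0 <= clamp z by have /andP[] := clamp_bounds z; lra.
  apply: (integral_square_ge s `[L, Rr]%classic _ i _ star_cdf lo hi eta) => //.
  - exact: star.1.
  - by move=> z y zh yh; exact: (payoff_ge0 _ _ _ _ _ _ nM).
  - move=> z z' zz'; rewrite /lo; have [_ cR'] := andP (clamp_bounds z').
    have : e * G (clamp z) <= e * G (clamp z').
      by rewrite ler_pM2l//; apply: gain_mono => //; exact: cmono.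
    move=> Gzz; rewrite ge_max !le_max lexx/=; apply/orP; right; lra.
  - by move=> z z' zz'; rewrite /hi ler_pM2l ?cmono// mulr_gt0.
  - by move=> z; rewrite /lo le_max lexx.
  - by move=> z; rewrite /hi !mulr_ge0// ltW.
  - move=> z y zA yA; have zh := LRD _ zA; have yh := LRD _ yA.
    move: zA; rewrite /= in_itv/= => /andP[Lz zR].
    rewrite /lo clamp_id// ge_max (payoff_ge0 _ _ _ _ _ _ nM)//=.
    have z0 : 0 <= z by lra.
    have zh' : z <= h by lra.
    have fz : f z <= f L by apply: demand_le => //; exact: ltW.
    have fz2 : Lam * f z <= 2 * e.
      have : Lam * f z <= Lam * (2 * r).
        by rewrite ler_pM2l//; have := demand_phi_L_lt; lra.
      by have := mul_rho; lra.
    have fl : (1 - theta) * Lam * f z - e <= (1 - theta) * e.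
      have h1 : 0 <= (1 - theta) * (2 * e - Lam * f z) by rewrite mulr_ge0//; lra.
      have h2 : 0 <= theta * e by rewrite mulr_ge0// ltW.
      lra.
    apply: le_trans (payoff_floor _ _ _ _ _ _ nM i z y zh yh fl).
    have -> : e * G z = (Lam * f z - e) * z.
      have -> : e * G z = Lam * (r * G z) by rewrite mulrA mul_rho.
      by rewrite gainE mulrA mulrBr mul_rho.
    have fz1 := demand_le1 _ z0 zh'; have fz0 := demand_gt0 _ z0 zh'.
    have h1 : 0 <= theta * Lam * (h - z).
      by rewrite mulr_ge0 ?subr_ge0// mulr_ge0// ltW.
    have h2 : 0 <= theta * Lam * z * (1 - f z).
      by rewrite mulr_ge0 ?subr_ge0// !mulr_ge0// ltW.
    lra.
  - move=> z y zA yA zy; have zh := LRD _ zA; have yh := LRD _ yA.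
    move: zA; rewrite /= in_itv/= => /andP[Lz zR].
    move: (yh); rewrite /= in_itv/= => /andP[y0 yh'].
    rewrite /hi clamp_id//; apply: (payoff_undercut _ _ _ _ _ _ nM) => //.
      by apply: gap => //; lra.
    by apply: capacity_demand => //; lra.
  - move=> z; rewrite /= in_itv/= => /andP[Lz zR].
    have /andP[F0 F1] := star_cdf_bounds (z + eta).
    have low := ler_wpM2l (ltW e0) (star_cdf_lower _ _ eta0 Lz zR).
    have : e * G z - theta * Lam * h <= lo z by rewrite /lo clamp_id// le_max lexx orbT.
    rewrite /hi clamp_id//; move: (lo z) => l lG.
    have h1 : 0 <= (l - (e * G z - theta * Lam * h)) * star_cdf (z + eta).
      by rewrite mulr_ge0 ?subr_ge0.
    have h2 : 0 <= theta * Lam * h * (1 - star_cdf (z + eta)).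
      by rewrite mulr_ge0 ?subr_ge0.
    have z0 : 0 <= z by lra.
    have h3 : 0 <= theta * e * z * star_cdf (z + eta).
      by rewrite mulr_ge0// !mulr_ge0// ltW.
    have h4 : 0 <= theta * e * (h - z).
      by rewrite mulr_ge0 ?subr_ge0 ?(le_trans zR Rh)// mulr_ge0// ltW.
    lra.
have -> : Defs.coord (other i) (s, s) = s by case: i {Dev Mix}.
apply: (le_trans Dev); apply: (@le_trans _ _
  ((e * L - eps / 4 - theta * (e + Lam) * h)%:E + eps%:E)%E); last by rewrite leeD2r.
rewrite -EFinD lee_fin; rewrite /B in th_eps; lra.
Qed.

End BelowTwoRho.
End ConcaveDemand.

Theorem theorem5 (R : realType) (phih : R) (f : R -> R) (Lam e : R)
  (phih_gt0 : 0 < phih)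
  (f_concave : strictly_concave_on `[0, phih]%classic f)
  (f_decr : strictly_decreasing_on `[0, phih]%classic f)
  (f_diff : forall phi, phi \in `[0, phih] -> derivable_within `[0, phih]%classic f phi)
  (f_bounds : forall phi, phi \in `[0, phih] -> 0 < f phi <= 1)
  (f0 : f 0 = 1)
  (Lam_gt0 : 0 < Lam)
  (e_gt0 : 0 < e)
  (rho_lt1 : rho Lam e < 1) :
  forall eps : R, 0 < eps ->
  exists2 beta_eps : R, 0 < beta_eps &
  forall beta : R, 0 < beta <= beta_eps ->
    [/\ rho Lam e <= f (phi_b phih f) / 2 ->
          pure_eps_nash phih (payoff f Lam e beta) eps
            (ext_inv phih f (2 * rho Lam e), ext_inv phih f (2 * rho Lam e)),
        f (phi_b phih f) / 2 < rho Lam e ->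
          exists2 sigma : probability R R,
            is_sigma_star phih f Lam e sigma &
            mixed_eps_nash phih (payoff f Lam e beta) eps (sigma, sigma) &
        f (phi_b phih f) / 2 < rho Lam e ->
          eps_equilibrium_cycle phih (payoff f Lam e beta) eps
            (phi_L phih f Lam e) (phi_R phih f Lam e)].
Proof.
move=> eps eps0.
have f_gt0 x : x \in `[0, phih] -> 0 < f x by move=> /f_bounds/andP[].
(* An accuracy theta is reached for all beta up to [e * theta ^+ 2], which turns each theta found
   above into a bound on beta. *)
have nearM theta beta : 0 < theta < 1 -> 0 < beta <= e * theta ^+ 2 ->
    near_limit phih f Lam e theta (payoff f Lam e beta).
  move=> /andP[th0 th1] /andP[b0 bth]; apply: payoff_near_limit => //.
  by rewrite ltW.
have [r_le|r_gt] := leP (rho Lam e) (f (phi_b phih f) / 2).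
  have [theta th nash] := pure_near_nash phih f phih_gt0 f_concave f_decr f_diff
    f_bounds f0 Lam e Lam_gt0 e_gt0 eps eps0 r_le.
  exists (e * theta ^+ 2).
    by case/andP: th => th0 _; rewrite mulr_gt0// exprn_gt0.
  by move=> beta /(nearM _ _ th)/nash ?; split.
have [th1 th1b mixed] := mixed_near_nash phih f phih_gt0 f_concave f_decr f_diff
  f_bounds f0 Lam e Lam_gt0 e_gt0 rho_lt1 r_gt eps eps0.
have [th2 th2b cycle] := cycle_near_limit phih f phih_gt0 f_concave f_decr f_diff
  f_bounds f0 Lam e Lam_gt0 e_gt0 rho_lt1 r_gt eps eps0.
exists (Num.min (e * th1 ^+ 2) (e * th2 ^+ 2)).
  case/andP: th1b => th10 _; case/andP: th2b => th20 _.
  by rewrite lt_min !mulr_gt0// exprn_gt0.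
move=> beta; rewrite le_min => /and3P[b0 b1 b2].
split=> // _.
  by apply/mixed/nearM => //; rewrite b0.
by apply/cycle/nearM => //; rewrite b0.
Qed.
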